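(* Let $q$ be a non-zero complex number which is not a root of unity, let $(\alpha,\beta)\in\mathbb{C}^2\setminus\{(0,0)\}$ and let $A_{\alpha,\beta}=U^+/\langle z-\alpha,z'-\beta\rangle$, where $U^+=U_q^+(B_2)$. Then the group $U(A_{\alpha,\beta})$ of invertible elements of $A_{\alpha,\beta}$ is $$U(A_{\alpha,\beta})=\begin{cases}\{\lambda\,\widetilde{e_3}^{\,i}\mid\lambda\in\mathbb{C}^*,\ i\in\mathbb{Z}\}&\text{if }\alpha=0,\\ \{\lambda\,(\widetilde{e_1}^{\,-1}\widetilde{e_3}^{\,2})^i\mid\lambda\in\mathbb{C}^*,\ i\in\mathbb{Z}\}&\text{if }\beta=0,\\ \mathbb{C}^*&\text{otherwise.}\end{cases}$$
   Context: $U^+=U_q^+(B_2)$ is the unital associative $\mathbb{C}$-algebra generated by $e_1,e_2$ subject to the quantum Serre relations $e_1^2e_2-(q^2+q^{-2})e_1e_2e_1+e_2e_1^2=0$ and $e_2^3e_1-(q^2+1+q^{-2})e_2^2e_1e_2+(q^2+1+q^{-2})e_2e_1e_2^2-e_1e_2^3=0$. Set $e_3=e_1e_2-q^2e_2e_1$, $\overline{e_3}=e_1e_2-q^{-2}e_2e_1$, $z=e_2e_3-q^2e_3e_2$ and $z'=(1-q^{-2})\left(e_3\overline{e_3}+(1+q^{-2})ze_1\right)$; the center of $U^+$ is $\mathbb{C}[z,z']$. $\langle z-\alpha,z'-\beta\rangle$ is the two-sided ideal of $U^+$ generated by $z-\alpha$ and $z'-\beta$, and $\widetilde{x}$ denotes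 the image of $x\in U^+$ in $A_{\alpha,\beta}$. $A_{\alpha,\beta}$ is a Noetherian domain, and negative powers of $\widetilde{e_1},\widetilde{e_3}$ are taken in the Ore localisation $A_{\alpha,\beta}\Sigma^{-1}\supseteq A_{\alpha,\beta}$ at the Ore set $\Sigma=\{\lambda\widetilde{e_3}^{\,i}\widetilde{e_1}^{\,j}\mid\lambda\in\mathbb{C}^*,\ i,j\in\mathbb{N}\}$. *)

(* Defs.v *)
From HB Require Import structures.
From mathcomp Require Import all_boot all_order all_algebra.
From mathcomp Require Import boolp classical_sets reals.
From mathcomp Require Import complex monalg.

Set Implicit Arguments.
Unset Strict Implicit.
Unset Printing Implicit Defensive.

Import Order.TTheory GRing.Theory Num.Theory.
Local Open Scope ring_scope.
Local Open Scope classical_set_scope.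
Local Open Scope quotient_scope.

(* MathComp only has quotients of commutative rings, by proper ideals. The    *)
(* quotient below is a pzRingType because it may be the zero ring for a       *)
(* general S; lalgType is not available for such rings, so the quotient is    *)
(* given its ring and module structures separately.                           *)
Section AlgebraQuotient.
Context {K : comNzRingType} {T : algType K}.

Definition two_sided_ideal (I : set T) :=
  [/\ I 0, (forall x y, I x -> I y -> I (x - y)),
      (forall a x, I x -> I (a * x)) & (forall a x, I x -> I (x * a))].

Variable S : set T.

Definition ideal_gen : set T := smallest two_sided_ideal S.

Lemma sub_ideal_gen x : S x -> ideal_gen x.
Proof. by move=> Sx I [_]; apply. Qed.

Lemma ideal_gen_ideal : two_sided_ideal ideal_gen.
Proof.
split.
- by move=> I [[I0 _ _ _] _].
- move=> x y Sx Sy I II; case: (II) => -[_ IB _ _] _.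
  by apply: IB; [exact: Sx|exact: Sy].
- by move=> a x Sx I II; case: (II) => -[_ _ IM _] _; apply: IM; exact: Sx.
- by move=> a x Sx I II; case: (II) => -[_ _ _ IM] _; apply: IM; exact: Sx.
Qed.

Let I0 : ideal_gen 0. Proof. by case: ideal_gen_ideal. Qed.
Let IB x y : ideal_gen x -> ideal_gen y -> ideal_gen (x - y).
Proof. by case: ideal_gen_ideal => _ + _ _; apply. Qed.
Let IMl a x : ideal_gen x -> ideal_gen (a * x).
Proof. by case: ideal_gen_ideal => _ _ + _; apply. Qed.
Let IMr a x : ideal_gen x -> ideal_gen (x * a).
Proof. by case: ideal_gen_ideal => _ _ _; apply. Qed.
Let IN x : ideal_gen x -> ideal_gen (- x).
Proof. by move=> Ix; rewrite -sub0r; apply: IB. Qed.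
Let ID x y : ideal_gen x -> ideal_gen y -> ideal_gen (x + y).
Proof. by move=> Ix Iy; rewrite -(opprK y); apply: IB => //; apply: IN. Qed.

Definition quot_rel : rel T := fun x y => `[< ideal_gen (x - y) >].

Lemma quot_rel_refl : reflexive quot_rel.
Proof. by move=> x; apply/asboolP; rewrite subrr. Qed.

Lemma quot_rel_sym : symmetric quot_rel.
Proof.
by move=> x y; apply/asboolP/asboolP => /IN; rewrite opprB.
Qed.

Lemma quot_rel_trans : transitive quot_rel.
Proof.
move=> y x z /asboolP xy /asboolP yz; apply/asboolP.
by rewrite -(subrK y x) -addrA; apply: ID.
Qed.

Canonical quot_equiv :=
  EquivRel quot_rel quot_rel_refl quot_rel_sym quot_rel_trans.

Definition alg_quot := {eq_quot quot_equiv}.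
HB.instance Definition _ := Choice.on alg_quot.

Definition quot_map : T -> alg_quot := \pi_{eq_quot quot_equiv}.

Lemma quot_mapP x y : quot_map x = quot_map y <-> ideal_gen (x - y).
Proof. by split=> [/eqmodP/asboolP|xy]; last exact/eqmodP/asboolP. Qed.

Lemma quot_map_surj (u : alg_quot) : exists x, quot_map x = u.
Proof. by exists (repr u); rewrite /quot_map reprK. Qed.

Let rep (u : alg_quot) : T := repr u.
Let repK u : quot_map (rep u) = u. Proof. exact: reprK. Qed.

Let zero := quot_map 0.
Let one := quot_map 1.
Let opp u := quot_map (- rep u).
Let add u v := quot_map (rep u + rep v).
Let mul u v := quot_map (rep u * rep v).
Let scale k u := quot_map (k *: rep u).

Let repP x : ideal_gen (rep (quot_map x) - x).
Proof. by apply/quot_mapP; rewrite repK. Qed.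

Let oppE x : opp (quot_map x) = quot_map (- x).
Proof. by apply/quot_mapP; rewrite -opprD; apply: IN; apply: repP. Qed.

Let addE x y : add (quot_map x) (quot_map y) = quot_map (x + y).
Proof.
by apply/quot_mapP; rewrite opprD addrACA; apply: ID; apply: repP.
Qed.

Let mulE x y : mul (quot_map x) (quot_map y) = quot_map (x * y).
Proof.
apply/quot_mapP; set a := rep _; set b := rep _.
have -> : a * b - x * y = (a - x) * b + x * (b - y).
  by rewrite mulrBl mulrBr addrA subrK.
by apply: ID; [apply: IMr|apply: IMl]; apply: repP.
Qed.

Let scaleE k x : scale k (quot_map x) = quot_map (k *: x).
Proof.
by apply/quot_mapP; rewrite -scalerBr -mulr_algl; apply: IMl; apply: repP.
Qed.

Let addA : associative add.
Proof.
move=> u v w; rewrite -(repK u) -(repK v) -(repK w) !addE.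
by rewrite addrA.
Qed.
Let addC : commutative add.
Proof. by move=> u v; rewrite -(repK u) -(repK v) !addE addrC. Qed.
Let add0 : left_id zero add.
Proof. by move=> u; rewrite -(repK u) addE add0r. Qed.
Let addN : left_inverse zero opp add.
Proof. by move=> u; rewrite -(repK u) oppE addE addNr. Qed.

HB.instance Definition _ :=
  GRing.isZmodule.Build alg_quot addA addC add0 addN.

Lemma quot_map_is_zmod_morphism : zmod_morphism quot_map.
Proof. by move=> x y; rewrite -addE -oppE. Qed.
HB.instance Definition _ :=
  GRing.isZmodMorphism.Build T alg_quot quot_map quot_map_is_zmod_morphism.

Let mulA : associative mul.
Proof.
move=> u v w; rewrite -(repK u) -(repK v) -(repK w) !mulE.
by rewrite mulrA.
Qed.
Let mul1 : left_id one mul.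
Proof. by move=> u; rewrite -(repK u) mulE mul1r. Qed.
Let mul1' : right_id one mul.
Proof. by move=> u; rewrite -(repK u) mulE mulr1. Qed.
Let mulDl : left_distributive mul +%R.
Proof.
move=> u v w; rewrite -(repK u) -(repK v) -(repK w).
by rewrite -raddfD !mulE -raddfD mulrDl.
Qed.
Let mulDr : right_distributive mul +%R.
Proof.
move=> u v w; rewrite -(repK u) -(repK v) -(repK w).
by rewrite -raddfD !mulE -raddfD mulrDr.
Qed.

HB.instance Definition _ := GRing.Zmodule_isPzRing.Build alg_quot
  mulA mul1 mul1' mulDl mulDr.

Lemma quot_map_is_monoid_morphism : monoid_morphism quot_map.
Proof. by split=> // x y; exact/esym/mulE. Qed.
HB.instance Definition _ :=
  GRing.isMonoidMorphism.Build T alg_quot quot_map quot_map_is_monoid_morphism.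

Let scaleA a b u : scale a (scale b u) = scale (a * b) u.
Proof. by rewrite -(repK u) !scaleE scalerA. Qed.
Let scale1 : left_id 1 scale.
Proof. by move=> u; rewrite -(repK u) scaleE scale1r. Qed.
Let scaleDr : right_distributive scale +%R.
Proof.
move=> a u v; rewrite -(repK u) -(repK v).
by rewrite -raddfD !scaleE -raddfD scalerDr.
Qed.
Let scaleDl u : {morph scale^~ u : a b / a + b}.
Proof. by move=> a b; rewrite -(repK u) !scaleE -raddfD scalerDl. Qed.

HB.instance Definition _ := GRing.Zmodule_isLmodule.Build K alg_quot
  scaleA scale1 scaleDr scaleDl.

Lemma quot_map_is_scalable : scalable quot_map.
Proof. by move=> a x; exact/esym/scaleE. Qed.
HB.instance Definition _ :=
  GRing.isScalable.Build K T alg_quot *:%R quot_map quot_map_is_scalable.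

Lemma quot_scalerAl k (u v : alg_quot) : k *: (u * v) = (k *: u) * v.
Proof.
rewrite -(repK u) -(repK v) -rmorphM -!linearZ -rmorphM.
by rewrite scalerAl.
Qed.

Lemma quot_scalerAr k (u v : alg_quot) : k *: (u * v) = u * (k *: v).
Proof.
rewrite -(repK u) -(repK v) -rmorphM -!linearZ -rmorphM.
by rewrite scalerAr.
Qed.
End AlgebraQuotient.

Arguments ideal_gen {K T} S.
Arguments alg_quot {K T} S.
Arguments quot_map {K T} S.

Lemma malg_scalerAr (K : comNzRingType) (M : monomType) k
    (x y : {malg K[M]}) : k *: (x * y) = x * (k *: y).
Proof.
have kC : k%:MP * x = x * k%:MP.
  rewrite !malgM_def fgmulUg fgmulgU; apply: eq_bigr => m _.
  by rewrite mulrC mul1m mulm1.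
by rewrite scalerAl -(mul_malgC k x) kC -mulrA mul_malgC.
Qed.

Section FreeAlgebra.
Variables (K : comNzRingType) (n : nat).

Definition free_alg := {malg K[{fmonom 'I_n}]}.
HB.instance Definition _ := GRing.Lalgebra.on free_alg.

HB.instance Definition _ :=
  GRing.Lalgebra_isAlgebra.Build K free_alg (@malg_scalerAr K _).

Definition free_gen (i : 'I_n) : free_alg := << fmu i >>.
End FreeAlgebra.

Section SerreRelations.
Variables (K : fieldType) (q : K).

Definition serre1 (T : algType K) (x1 x2 : T) : T :=
  x1 ^+ 2 * x2 - (q ^+ 2 + q ^- 2) *: (x1 * x2 * x1) + x2 * x1 ^+ 2.

Definition serre2 (T : algType K) (x1 x2 : T) : T :=
  x2 ^+ 3 * x1 - (q ^+ 2 + 1 + q ^- 2) *: (x2 ^+ 2 * x1 * x2)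
  + (q ^+ 2 + 1 + q ^- 2) *: (x2 * x1 * x2 ^+ 2) - x1 * x2 ^+ 3.

Lemma lrmorph_serre1 (T T' : algType K) (f : {lrmorphism T -> T'}) x1 x2 :
  f (serre1 x1 x2) = serre1 (f x1) (f x2).
Proof.
rewrite /serre1 !exprS !expr0 !mulr1 rmorphD rmorphB.
by rewrite /= [f (_ *: _)]linearZ /= !rmorphM.
Qed.

Lemma lrmorph_serre2 (T T' : algType K) (f : {lrmorphism T -> T'}) x1 x2 :
  f (serre2 x1 x2) = serre2 (f x1) (f x2).
Proof.
rewrite /serre2 !exprS !expr0 !mulr1 rmorphB rmorphD rmorphB.
by rewrite /= ![f (_ *: _)]linearZ /= !rmorphM.
Qed.

Section Augmentation.
Variables (T : algType K) (x1 x2 : T) (c : {rmorphism T -> K}).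
Hypotheses (cZ : forall k x, c (k *: x) = k * c x).
Hypotheses (c1 : c x1 = 0) (c2 : c x2 = 0).

Lemma serre1_augmentation : c (serre1 x1 x2) = 0.
Proof.
rewrite /serre1 !exprS !expr0 !mulr1 rmorphD rmorphB cZ !rmorphM c1 c2.
by rewrite !(mulr0, subr0, addr0).
Qed.

Lemma serre2_augmentation : c (serre2 x1 x2) = 0.
Proof.
rewrite /serre2 !exprS !expr0 !mulr1 rmorphB rmorphD rmorphB !cZ !rmorphM.
by rewrite c1 c2 !(mulr0, subr0, addr0).
Qed.
End Augmentation.
End SerreRelations.

Section UqB2.
Variables (K : fieldType) (q : K).

Let E1 : free_alg K 2 := free_gen K (0 : 'I_2).
Let E2 : free_alg K 2 := free_gen K (1 : 'I_2).

Definition Uplus := alg_quot [set serre1 q E1 E2; serre2 q E1 E2].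
HB.instance Definition _ := GRing.PzRing.on Uplus.
HB.instance Definition _ := GRing.Lmodule.on Uplus.

Let Uplus_neq0 : (1 : Uplus) != 0.
Proof.
apply/eqP => /(quot_mapP _ _ _).1; rewrite subr0.
have [c0 c0E c0Z] : exists2 c0 : {rmorphism free_alg K 2 -> K},
    forall i, c0 (free_gen K i) = 0 & forall k x, c0 (k *: x) = k * c0 x.
  exists (mcoeff mone : {rmorphism {malg K[{fmonom 'I_2}]} -> K}).
    move=> i; rewrite /free_gen /= mcoeffU1.
    by case: eqP => // /(congr1 (@fmonom_val _)); rewrite fmuE fm1.
  by move=> k x; exact: mcoeffZ.
move=> /(_ [set x : free_alg K 2 | c0 x = 0]) I1.
suff : c0 1 = 0 by apply/eqP; rewrite rmorph1 oner_eq0.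
apply: I1; split.
  split => /= [|x y x0 y0|a x x0|a x x0].
  - exact: rmorph0.
  - by rewrite (rmorphB c0) x0 y0 subr0.
  - by rewrite (rmorphM c0) x0 mulr0.
  - by rewrite (rmorphM c0) x0 mul0r.
move=> x [->|->] /=.
- by apply: serre1_augmentation; first exact: c0Z; exact: c0E.
- by apply: serre2_augmentation; first exact: c0Z; exact: c0E.
Qed.
HB.instance Definition _ := GRing.PzSemiRing_isNonZero.Build Uplus Uplus_neq0.
HB.instance Definition _ :=
  GRing.Lmodule_isLalgebra.Build K Uplus (@quot_scalerAl _ _ _).
HB.instance Definition _ :=
  GRing.Lalgebra_isAlgebra.Build K Uplus (@quot_scalerAr _ _ _).

Definition Umap : free_alg K 2 -> Uplus := quot_map _.
HB.instance Definition _ := GRing.RMorphism.on Umap.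
HB.instance Definition _ := GRing.Linear.on Umap.

Definition e1 : Uplus := Umap E1.
Definition e2 : Uplus := Umap E2.

Lemma Uplus_serre1 : serre1 q e1 e2 = 0.
Proof.
rewrite -lrmorph_serre1 -(rmorph0 Umap).
by apply/quot_mapP; rewrite subr0; apply: sub_ideal_gen; left.
Qed.

Lemma Uplus_serre2 : serre2 q e1 e2 = 0.
Proof.
rewrite -lrmorph_serre2 -(rmorph0 Umap).
by apply/quot_mapP; rewrite subr0; apply: sub_ideal_gen; right.
Qed.

Definition e3 : Uplus := e1 * e2 - q ^+ 2 *: (e2 * e1).
Definition e3bar : Uplus := e1 * e2 - q ^- 2 *: (e2 * e1).
Definition z : Uplus := e2 * e3 - q ^+ 2 *: (e3 * e2).
Definition z' : Uplus :=
  (1 - q ^- 2) *: (e3 * e3bar + (1 + q ^- 2) *: (z * e1)).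

Definition Aquot (alpha beta : K) :=
  alg_quot [set z - alpha%:A; z' - beta%:A].
HB.instance Definition _ a b := GRing.PzRing.on (Aquot a b).
HB.instance Definition _ a b := GRing.Lmodule.on (Aquot a b).

Definition Amap (alpha beta : K) : Uplus -> Aquot alpha beta := quot_map _.
HB.instance Definition _ a b := GRing.RMorphism.on (Amap a b).
HB.instance Definition _ a b := GRing.Linear.on (Amap a b).

Lemma Amap_z alpha beta : Amap alpha beta z = alpha *: (1 : Aquot alpha beta).
Proof.
rewrite -(rmorph1 (Amap alpha beta)) -linearZ.
by apply/quot_mapP; apply: sub_ideal_gen; left.
Qed.

Lemma Amap_z' alpha beta : Amap alpha beta z' = beta *: (1 : Aquot alpha beta).
Proof.
rewrite -(rmorph1 (Amap alpha beta)) -linearZ.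
by apply/quot_mapP; apply: sub_ideal_gen; right.
Qed.
End UqB2.

Arguments Aquot {K} q alpha beta.
Arguments Amap {K} q alpha beta.

Section OreLocalization.
Variables (A : pzRingType) (Sigma : set A).

Definition invertible : set A := [set u | exists v, u * v = 1 /\ v * u = 1].

(* The ring of right fractions of A with respect to Sigma, characterised up   *)
(* to unique isomorphism over A. Every nonzero ring is classically a          *)
(* unitRingType, and 0 is not in Sigma for an Ore set of a domain, so asking  *)
(* for a unitRingType is no restriction there.                                *)
Definition is_Ore_localization (B : unitRingType) (f : {rmorphism A -> B}) :=
  [/\ forall s, Sigma s -> f s \is a GRing.unit,
      forall b, exists a s, Sigma s /\ b = f a / f s &
      forall a, f a = 0 <-> exists2 s, Sigma s & a * s = 0].
End OreLocalization.

Section Localization.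
Variables (K : fieldType) (q alpha beta : K).

Definition Aconst (c : K) : Aquot q alpha beta :=
  c *: (1 : Aquot q alpha beta).
Definition te1 : Aquot q alpha beta := Amap q alpha beta (e1 q).
Definition te3 : Aquot q alpha beta := Amap q alpha beta (e3 q).

Definition Sigma : set (Aquot q alpha beta) :=
  [set s | exists (c : K) (i j : nat), c != 0 /\ s = c *: (te3 ^+ i * te1 ^+ j)].
End Localization.

Arguments invertible A : clear implicits.
Arguments Aconst {K} q alpha beta c.
Arguments te1 {K} q alpha beta.
Arguments te3 {K} q alpha beta.
Arguments Sigma {K} q alpha beta.

(* Main.v *)
(* In A = A_{alpha,beta} the commutator w = e2 e3 - e3 e2 equals              *)
(* (q^2 - 1) e3 e2 + alpha, and the relation z' = beta says that w e1 is a    *)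
(* polynomial in e3. Hence e1 and e3 generate, after localisation at their    *)
(* monomials, a quantum torus, in which leading and trailing terms for a      *)
(* lexicographic order show that the units are the monomials. So every unit u *)
(* of A satisfies u m = k m' for a scalar k and monomials m, m' in e3, e1,    *)
(* and it remains to see which exponents can occur. If beta <> 0, A acts on   *)
(* sequences with e3 diagonal and invertible and e1 lowering the degree by 1; *)
(* comparing the degrees of m and m' there shows that they have the same      *)
(* exponent of e1. If alpha <> 0, A acts on sequences with e3 lowering the    *)
(* degree by 1 and w diagonal and invertible, so that e1 lowers the degree by *)
(* 0 if beta <> 0 and by 2 if beta = 0; this controls the exponent of e3.     *)
(* Conversely e3 is a unit of A if alpha = 0, and w, which is proportional to *)
(* e1^-1 e3^2, is a unit if beta = 0.                                         *)

Require Import Defs.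
From HB Require Import structures.
From mathcomp Require Import all_boot all_order all_algebra.
From mathcomp Require Import boolp classical_sets reals.
From mathcomp Require Import complex finmap monalg.
From mathcomp Require Import ring zify.
Import Order.TTheory GRing.Theory Num.Theory.
Local Open Scope ring_scope.
Local Open Scope classical_set_scope.

Set Implicit Arguments.
Unset Strict Implicit.
Unset Printing Implicit Defensive.

(** * The algebra of linear operators on sequences *)

(** In the torus generated by e1 and e3 the relations can be solved for e2, which gives [torus_e2]
    and a map from A to the torus. Conversely, multiplying any element of A on the right by a high
    enough monomial turns it into a polynomial in e1 and e3 ([eventually_poly]), and such a
    polynomial can be read off from its image. Hence the kernel consists of elements killed by
    monomials ([ker_torus]), every element of the torus is a fraction ([torus_fraction]), and the
    torus is a model of the Ore localisation.

    A unit of A maps to a unit of the torus, which is a scalar times a monomial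
    ([qtorus_unit_monomial]). Pulled back to A this reads u m = k m' with m, m' monomials
    ([unit_monomial]).

    In a module of sequences u acts invertibly, so m and m' kill the same sequences. If m lowers
    degrees by r, the finitely supported sequences it kills are those of degree less than r, so r is
    the same for m and m' ([lowers_unit_eq]). The two families of modules, [lw_relations] and
    [hw_relations], give one linear equation each on the exponents. Together these leave only
    scalars if alpha and beta are nonzero, and otherwise only powers of one element, whose inverse
    is written down in [y3_invertible] and [ww_invertible]. *)

Section SequenceOperators.
Variable K : fieldType.

(** A single pointwise equation, so that closure properties become identities in [K] within reach of
    [ring]. *)
Definition seq_linear (F : (nat -> K) -> nat -> K) :=
  forall a f g k, F (fun i => a * f i + g i) k = a * F f k + F g k.

Record seq_op := SeqOp {
  seq_op_fun :> (nat -> K) -> nat -> K;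
  seq_op_linear : seq_linear seq_op_fun }.

Implicit Types P Q S : seq_op.

Lemma seq_opP P Q : (forall f k, P f k = Q f k) -> P = Q.
Proof.
case: P Q => [P Plin] [Q Qlin] /= PQ.
have {}PQ : P = Q by apply/funext => f; apply/funext => k.
by subst Q; congr SeqOp; apply: Prop_irrelevance.
Qed.

HB.instance Definition _ := gen_eqMixin seq_op.
HB.instance Definition _ := gen_choiceMixin seq_op.

Lemma seq_opD P f g k : P (fun i => f i + g i) k = P f k + P g k.
Proof.
rewrite -[P f k]mul1r -seq_op_linear.
by congr (P _ k); apply/funext => i; rewrite mul1r.
Qed.

Lemma seq_op0 P k : P (fun=> 0) k = 0.
Proof.
have := seq_opD P (fun=> 0) (fun=> 0) k.
under [X in P X k]eq_fun do rewrite addr0.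
by move/eqP; rewrite -subr_eq0 opprD addNKr oppr_eq0 => /eqP.
Qed.

Lemma seq_opZ P a f k : P (fun i => a * f i) k = a * P f k.
Proof.
rewrite -[RHS]addr0 -[X in _ + X](seq_op0 P k) -seq_op_linear.
by congr (P _ k); apply/funext => i; rewrite addr0.
Qed.

Fact seq_op_zero_subproof : seq_linear (fun _ _ => 0).
Proof. by move=> a f g k; rewrite mulr0 addr0. Qed.
Definition seq_op_zero := SeqOp seq_op_zero_subproof.

Fact seq_op_one_subproof : seq_linear id.
Proof. by []. Qed.
Definition seq_op_one := SeqOp seq_op_one_subproof.

Fact seq_op_add_subproof P Q : seq_linear (fun f k => P f k + Q f k).
Proof. by move=> a f g k; rewrite !seq_op_linear; ring. Qed.
Definition seq_op_add P Q := SeqOp (@seq_op_add_subproof P Q).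

Fact seq_op_scale_subproof c P : seq_linear (fun f k => c * P f k).
Proof. by move=> a f g k; rewrite !seq_op_linear; ring. Qed.
Definition seq_op_scale c P := SeqOp (@seq_op_scale_subproof c P).

Fact seq_op_mul_subproof P Q : seq_linear (fun f => P (Q f)).
Proof.
move=> a f g k; rewrite -seq_op_linear.
by congr (P _ k); apply/funext => i; rewrite seq_op_linear.
Qed.
Definition seq_op_mul P Q := SeqOp (@seq_op_mul_subproof P Q).

Definition seq_op_opp := seq_op_scale (-1).

Fact seq_op_addA : associative seq_op_add.
Proof. by move=> P Q S; apply: seq_opP => f k /=; rewrite addrA. Qed.
Fact seq_op_addC : commutative seq_op_add.
Proof. by move=> P Q; apply: seq_opP => f k /=; rewrite addrC. Qed.
Fact seq_op_add0 : left_id seq_op_zero seq_op_add.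
Proof. by move=> P; apply: seq_opP => f k /=; rewrite add0r. Qed.
Fact seq_op_addN : left_inverse seq_op_zero seq_op_opp seq_op_add.
Proof. by move=> P; apply: seq_opP => f k /=; rewrite mulN1r addNr. Qed.

HB.instance Definition _ :=
  GRing.isZmodule.Build seq_op seq_op_addA seq_op_addC seq_op_add0 seq_op_addN.

Fact seq_op_mulA : associative seq_op_mul.
Proof. by move=> P Q S; apply: seq_opP. Qed.
Fact seq_op_mul1 : left_id seq_op_one seq_op_mul.
Proof. by move=> P; apply: seq_opP. Qed.
Fact seq_op_mul1r : right_id seq_op_one seq_op_mul.
Proof. by move=> P; apply: seq_opP. Qed.
Fact seq_op_mulDl : left_distributive seq_op_mul +%R.
Proof. by move=> P Q S; apply: seq_opP. Qed.
Fact seq_op_mulDr : right_distributive seq_op_mul +%R.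
Proof. by move=> P Q S; apply: seq_opP => f k /=; rewrite seq_opD. Qed.
Fact seq_op_neq0 : seq_op_one != 0.
Proof.
apply/eqP => /(congr1 (fun P : seq_op => P (fun=> 1) 0%N)) /= /eqP.
by rewrite oner_eq0.
Qed.

HB.instance Definition _ := GRing.Zmodule_isNzRing.Build seq_op
  seq_op_mulA seq_op_mul1 seq_op_mul1r seq_op_mulDl seq_op_mulDr seq_op_neq0.

Fact seq_op_scaleA a b P : seq_op_scale a (seq_op_scale b P) = seq_op_scale (a * b) P.
Proof. by apply: seq_opP => f k /=; rewrite mulrA. Qed.
Fact seq_op_scale1 : left_id 1 seq_op_scale.
Proof. by move=> P; apply: seq_opP => f k /=; rewrite mul1r. Qed.
Fact seq_op_scaleDr : right_distributive seq_op_scale +%R.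
Proof. by move=> a P Q; apply: seq_opP => f k /=; rewrite mulrDr. Qed.
Fact seq_op_scaleDl P : {morph seq_op_scale^~ P : a b / a + b}.
Proof. by move=> a b; apply: seq_opP => f k /=; rewrite mulrDl. Qed.

HB.instance Definition _ := GRing.Zmodule_isLmodule.Build K seq_op
  seq_op_scaleA seq_op_scale1 seq_op_scaleDr seq_op_scaleDl.

Fact seq_op_scaleAl a P Q : a *: (P * Q) = (a *: P) * Q.
Proof. by apply: seq_opP. Qed.
HB.instance Definition _ := GRing.Lmodule_isLalgebra.Build K seq_op seq_op_scaleAl.
Fact seq_op_scaleAr a P Q : a *: (P * Q) = P * (a *: Q).
Proof. by apply: seq_opP => f k /=; rewrite seq_opZ. Qed.
HB.instance Definition _ := GRing.Lalgebra_isAlgebra.Build K seq_op seq_op_scaleAr.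

Lemma seq_opDE P Q f k : (P + Q) f k = P f k + Q f k. Proof. by []. Qed.
Lemma seq_opNE P f k : (- P) f k = - P f k.
Proof. by rewrite -[RHS]mulN1r. Qed.
Lemma seq_opME P Q f : (P * Q) f = P (Q f). Proof. by []. Qed.
Lemma seq_opZE a P f k : (a *: P) f k = a * P f k. Proof. by []. Qed.
Lemma seq_op1E f : (1 : seq_op) f = f. Proof. by []. Qed.
Definition seq_opE := (seq_opDE, seq_opNE, seq_opME, seq_opZE, seq_op1E).

End SequenceOperators.

(** * Universal properties *)

Section AlgebraLifts.
Variables (K : comNzRingType) (E : algType K).

Lemma free_alg_lift n (x : 'I_n -> E) :
  exists phi : {lrmorphism free_alg K n -> E}, forall i, phi (free_gen K i) = x i.
Proof.
pose h (m : {fmonom 'I_n}) : E := \prod_(i <- m) x i.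
have hM : mmorphism h.
  split=> [m1 m2|]; first by rewrite /h fmM big_cat.
  by rewrite /h fm1 big_nil.
pose hB := isMultiplicative.Build _ _ h hM.
pose hm : {mmorphism {fmonom 'I_n} -> E} := HB.pack h hB.
pose f : {rmorphism K -> E} := in_alg E.
(* Evaluation of words is multiplicative because scalars are central in [E]. *)
have comm_f (g : {malg K[{fmonom 'I_n}]}) m m' : GRing.comm (f g@_m) (hm m').
  by rewrite /GRing.comm /= -scalerAl mul1r -scalerAr mulr1.
have phiM := commr_mmap_is_multiplicative comm_f.
pose phi0 : free_alg K n -> E := mmap f hm.
have phiB : zmod_morphism phi0 by move=> u v; rewrite /phi0 raddfB.
have phiZ : scalable phi0.
  by move=> c g; rewrite /phi0 mmapZ /= -scalerAl mul1r.
pose B1 := GRing.isZmodMorphism.Build _ _ phi0 phiB.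
pose B2 := GRing.isMonoidMorphism.Build _ _ phi0 (conj phiM.2 phiM.1).
pose B3 := GRing.isScalable.Build _ _ _ _ phi0 phiZ.
pose phi : {lrmorphism free_alg K n -> E} := HB.pack phi0 B1 B2 B3.
exists phi => i; rewrite /= /phi0 /free_gen mmapU /= scale1r mul1r.
by rewrite /h fmuE big_seq1.
Qed.

(** Compatibility with scalars is a separate conclusion because [alg_quot S] may be the zero ring
    and so has no [lalgType] structure. *)
Lemma alg_quot_lift (T : algType K) (S : set T) (phi : {lrmorphism T -> E}) :
    (forall x, S x -> phi x = 0) ->
  exists2 psi : {rmorphism alg_quot S -> E},
    forall x, psi (quot_map S x) = phi x &
    forall k u, psi (k *: u) = k *: psi u.
Proof.
move=> S0.
have phi0 x : ideal_gen S x -> phi x = 0.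
  move=> /(_ [set y | phi y = 0]); apply; split; last exact: S0.
  split; rewrite /mkset.
  - exact: rmorph0.
  - by move=> y t y0 t0; rewrite rmorphB /= y0 t0 subr0.
  - by move=> a y y0; rewrite rmorphM /= y0 mulr0.
  - by move=> a y y0; rewrite rmorphM /= y0 mul0r.
pose psi0 (u : alg_quot S) : E := phi (repr u).
have psiE x : psi0 (quot_map S x) = phi x.
  apply/eqP; rewrite -subr_eq0 -rmorphB; apply/eqP/phi0/quot_mapP.
  exact: reprK.
have surj (u : alg_quot S) : exists x, u = quot_map S x.
  by have [x <-] := quot_map_surj u; exists x.
have psiB : zmod_morphism psi0.
  move=> u v; have [[x ->] [y ->]] := (surj u, surj v).
  by rewrite -rmorphB !psiE rmorphB.
have psiM : monoid_morphism psi0.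
  split=> [|u v]; first by rewrite -(rmorph1 (quot_map S)) psiE rmorph1.
  have [[x ->] [y ->]] := (surj u, surj v).
  by rewrite -rmorphM !psiE rmorphM.
pose B1 := GRing.isZmodMorphism.Build _ _ psi0 psiB.
pose B2 := GRing.isMonoidMorphism.Build _ _ psi0 psiM.
pose psi : {rmorphism alg_quot S -> E} := HB.pack psi0 B1 B2.
exists psi => [//|k u]; have [x ->] := surj u.
by rewrite -linearZ /= !psiE linearZ.
Qed.

End AlgebraLifts.

(** * The quantum torus and its units *)

Section LinearExtension.
Variables (K : fieldType) (I : choiceType) (V : lmodType K).
Implicit Types (F : I -> V) (x y : {malg K[I]}).

Definition malg_ext F x : V := \sum_(m <- msupp x) x@_m *: F m.

Lemma malg_extEw (d : {fset I}) F x : (msupp x `<=` d)%fset ->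
  malg_ext F x = \sum_(m <- d) x@_m *: F m.
Proof.
move=> le; rewrite [LHS](big_fset_incl _ le) => //= m _ /mcoeff_outdom ->.
by rewrite scale0r.
Qed.

Lemma malg_ext_is_linear F : linear (malg_ext F).
Proof.
move=> a x y; pose d := (msupp x `|` msupp y `|` msupp (a *: x + y))%fset.
have [dx dy dz] : [/\ msupp x `<=` d, msupp y `<=` d & msupp (a *: x + y) `<=` d]%fset.
  by split; apply/fsubsetP => m; rewrite !inE => ->; rewrite ?orbT.
rewrite (malg_extEw F dx) (malg_extEw F dy) (malg_extEw F dz).
rewrite scaler_sumr -big_split /=; apply: eq_bigr => m _.
by rewrite mcoeffD mcoeffZ scalerDl scalerA.
Qed.

HB.instance Definition _ F :=
  GRing.isLinear.Build K {malg K[I]} V _ (malg_ext F) (malg_ext_is_linear F).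

Lemma malg_extU F m : malg_ext F << m >> = F m.
Proof. by rewrite (malg_extEw F msuppU_le) big_seq_fset1 mcoeffUU scale1r. Qed.

Lemma malg_ext_linear_fun a F G x :
  malg_ext (fun m => a *: F m + G m) x = a *: malg_ext F x + malg_ext G x.
Proof.
rewrite /malg_ext scaler_sumr -big_split; apply: eq_bigr => m _ /=.
by rewrite scalerDr !scalerA mulrC.
Qed.

Lemma eq_malg_ext F G : F =1 G -> malg_ext F =1 malg_ext G.
Proof. by move=> FG x; apply: eq_bigr => m _; rewrite FG. Qed.

End LinearExtension.

Section LinearFunctions.
Variables (K : fieldType) (U V W : lmodType K).

Lemma linear_fun_comp (f : V -> W) (g : U -> V) :
  linear f -> linear g -> linear (f \o g).
Proof. by move=> fL gL a x y; rewrite /= gL fL. Qed.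

Lemma linear_funD (f : V -> W) : linear f -> {morph f : x y / x + y}.
Proof. by move=> fL x y; rewrite -[x]scale1r fL !scale1r. Qed.

Lemma linear_funZ (f : V -> W) : linear f -> forall a, {morph f : x / a *: x}.
Proof.
move=> fL; have f0 : f 0 = 0.
  by apply: (addrI (f 0)); rewrite -(linear_funD fL) !addr0.
by move=> a x; rewrite -[a *: x]addr0 fL f0 addr0.
Qed.

End LinearFunctions.

Section MalgBasis.
Variables (K : fieldType) (I : choiceType).

Lemma malg_basisE (x : {malg K[I]}) :
  x = \sum_(m <- msupp x) x@_m *: << m >>.
Proof.
rewrite [LHS]monalgE; apply: eq_bigr => m _; apply/malgP => k.
by rewrite mcoeffZ !mcoeffU mulr_natr.
Qed.

Lemma malg_linearP (V : lmodType K) (f g : {malg K[I]} -> V) :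
  linear f -> linear g -> (forall m, f << m >> = g << m >>) -> f =1 g.
Proof.
move=> fL gL fg x; pose fB := GRing.isLinear.Build K _ _ _ f fL.
pose gB := GRing.isLinear.Build K _ _ _ g gL.
pose f' : {linear _ -> _} := HB.pack f fB.
pose g' : {linear _ -> _} := HB.pack g gB.
rewrite -[f]/(f' : _ -> _) -[g]/(g' : _ -> _) (malg_basisE x) !linear_sum.
by apply: eq_bigr => m _; rewrite !linearZ /= fg.
Qed.

End MalgBasis.

(* The basis element << (i, j) >> is the monomial Y^j X^i, where              *)
(* X Y = r Y X.                                                               *)
Section QuantumTorus.
Variables (K : fieldType) (r : K) (r_neq0 : r != 0).

(** The argument keeps [r] visible in the type, so that the product may depend on it. *)
Definition qtorus of r != 0 := {malg K[(int * int)%type]}.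
Local Notation T := (qtorus r_neq0).
HB.instance Definition _ := GRing.Lmodule.on T.

Implicit Types (m n p : int * int) (x y z : T).

(** The scalar produced by moving the power of X in the first monomial past the power of Y in the
    second. It is bimultiplicative, hence a 2-cocycle, which is what associativity requires. *)
Definition qtorus_cocycle m n : K := r ^ (m.1 * n.2).
Local Notation chi := qtorus_cocycle.

Definition qtorus_U m : T := << m >>.
Local Notation U := qtorus_U.

Let lmul m : T -> T := malg_ext (fun n => chi m n *: U (m + n)).

Definition qtorus_mul x y : T := malg_ext (fun m => lmul m y) x.
Local Notation mul := qtorus_mul.

Fact qtorus_mul_linearl y : linear (mul^~ y).
Proof. by move=> a x z; rewrite /mul linearP. Qed.

Fact qtorus_mul_linearr x : linear (mul x).
Proof.
move=> a y z.
apply: etrans (malg_ext_linear_fun a (fun m => lmul m y) (fun m => lmul m z) x).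
by apply: eq_malg_ext => m; exact: malg_ext_is_linear.
Qed.

Fact qtorus_mulUU m n : mul (U m) (U n) = chi m n *: U (m + n).
Proof. by rewrite /mul malg_extU /lmul malg_extU. Qed.

Let TmulDl : left_distributive mul +%R.
Proof. by move=> x y z; exact: (linear_funD (qtorus_mul_linearl z)). Qed.
Let TmulDr : right_distributive mul +%R.
Proof. by move=> z x y; exact: (linear_funD (qtorus_mul_linearr z)). Qed.
Let TmulZl a x y : mul (a *: x) y = a *: mul x y.
Proof. exact: (linear_funZ (qtorus_mul_linearl y)). Qed.
Let TmulZr a x y : mul x (a *: y) = a *: mul x y.
Proof. exact: (linear_funZ (qtorus_mul_linearr x)). Qed.

Let cocycleE m n p : chi n p * chi m (n + p) = chi m n * chi (m + n) p.
Proof. by rewrite /chi -!expfzDr //=; congr (r ^ _); ring. Qed.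

Let TmulA : associative mul.
Proof.
have linl := qtorus_mul_linearl; have linr := qtorus_mul_linearr.
move=> x y z; move: x.
apply: malg_linearP; first exact: linl.
  exact: (linear_fun_comp (linl z) (linl y)).
move=> m; move: y; apply: malg_linearP.
- exact: (linear_fun_comp (linr (U m)) (linl z)).
- exact: (linear_fun_comp (linl z) (linr (U m))).
move=> n; move: z; apply: malg_linearP.
- exact: (linear_fun_comp (linr (U m)) (linr (U n))).
- exact: linr.
move=> p; rewrite -![<< _ >>]/(U _) !(qtorus_mulUU, TmulZl, TmulZr) !scalerA.
by rewrite addrA cocycleE.
Qed.

Let Tmul1l : left_id (U 0) mul.
Proof.
move=> x; move: x; apply: malg_linearP; [exact: qtorus_mul_linearr|by []|].
by move=> m; rewrite -![<< _ >>]/(U _) qtorus_mulUU /chi /= mul0r scale1r add0r.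
Qed.
Let Tmul1r : right_id (U 0) mul.
Proof.
move=> x; move: x; apply: malg_linearP; [exact: qtorus_mul_linearl|by []|].
by move=> m; rewrite -![<< _ >>]/(U _) qtorus_mulUU /chi /= mulr0 scale1r addr0.
Qed.
Let one_neq0 : U 0 != 0.
Proof. by rewrite monalgU_eq0 oner_eq0. Qed.

HB.instance Definition _ := GRing.Zmodule_isNzRing.Build T
  TmulA Tmul1l Tmul1r TmulDl TmulDr one_neq0.
HB.instance Definition _ := GRing.Lmodule_isLalgebra.Build K T
  (fun a x y => esym (TmulZl a x y)).
HB.instance Definition _ := GRing.Lalgebra_isAlgebra.Build K T
  (fun a x y => esym (TmulZr a x y)).

Lemma qtorus_UU m n : U m * U n = r ^ (m.1 * n.2) *: U (m + n).
Proof. exact: qtorus_mulUU. Qed.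

Lemma qtorus_1 : 1 = U 0. Proof. by []. Qed.

Lemma qtorus_U_inv m : exists t : T, t * U m = 1 /\ U m * t = 1.
Proof.
have cancel_r (k l : int) : k + l = 0 -> r ^ k * r ^ l = 1.
  by move=> kl; rewrite -(expfzDr k l r_neq0) kl expr0z.
have rm : r ^ (m.1 * m.2) * r ^ ((- m).1 * m.2) = 1.
  by apply: cancel_r; rewrite mulNr addrN.
have rm' : r ^ (m.1 * m.2) * r ^ (m.1 * (- m).2) = 1.
  by apply: cancel_r; rewrite mulrN addrN.
exists (r ^ (m.1 * m.2) *: U (- m)); split.
  transitivity (r ^ (m.1 * m.2) *: (U (- m) * U m)); first exact/esym/scalerAl.
  by rewrite qtorus_UU scalerA rm scale1r addNr.
transitivity (r ^ (m.1 * m.2) *: (U m * U (- m))); first exact/esym/scalerAr.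
by rewrite qtorus_UU scalerA rm' scale1r addrN.
Qed.

Lemma qtorus_coefM x y p :
  (x * y)@_p = \sum_(m <- msupp x) x@_m * (r ^ (m.1 * (p - m).2) * y@_(p - m)).
Proof.
rewrite {1}/GRing.mul /= /mul /malg_ext raddf_sum; apply: eq_bigr => m _.
rewrite /= mcoeffZ; congr (_ * _); move: y.
apply: (malg_linearP (V := K^o)).
- by move=> a y y'; rewrite /lmul linearP mcoeffD mcoeffZ.
- by move=> a y y'; rewrite mcoeffD mcoeffZ mulrDr mulrCA.
move=> n; rewrite /lmul malg_extU mcoeffZ !mcoeffU /chi.
rewrite (can2_eq (addKr m) (addNKr m)) [- m + p]addrC.
by case: eqP => [->|_]; rewrite ?mulr0.
Qed.

End QuantumTorus.

(** * Leading and trailing monomials in the quantum torus *)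

Section LeadingTerms.
Variables (K : fieldType) (r : K) (r_neq0 : r != 0).
Local Notation T := (qtorus r_neq0).
Local Notation U := (qtorus_U r_neq0).

Definition lex_lt (m n : int * int) :=
  (m.1 < n.1) || (m.1 == n.1) && (m.2 < n.2).
(** A leading monomial for the reversed order is a trailing monomial, so one argument for
    translation-invariant orders serves both ends. *)
Definition lex_gt (m n : int * int) := lex_lt n m.

Lemma lex_lt_total m n : [\/ lex_lt m n, m = n | lex_lt n m].
Proof.
case: m n => [a b] [c d]; rewrite /lex_lt /=.
case: (ltgtP a c) => [||->] /=; [by constructor 1|by constructor 3|].
by case: (ltgtP b d) => [||->]; [constructor 1|constructor 3|constructor 2].
Qed.

Lemma lex_lt_irr : irreflexive lex_lt.
Proof. by case=> a b; rewrite /lex_lt /= !ltxx andbF. Qed.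

Lemma lex_lt_trans : transitive lex_lt.
Proof.
move=> [a b] [c d] [e f]; rewrite /lex_lt /=.
move=> /orP[ca|/andP[/eqP-> db]] /orP[ae|/andP[/eqP<- bf]].
- by rewrite (lt_trans ca ae).
- by rewrite ca.
- by rewrite ae.
- by rewrite eqxx (lt_trans db bf) orbT.
Qed.

Lemma lex_ltD p m n : lex_lt m n -> lex_lt (p + m) (p + n).
Proof.
by rewrite /lex_lt /= !ltrD2l (inj_eq (addrI _)).
Qed.

Definition leading (lt : rel (int * int)) (x : T) m :=
  x@_m != 0 /\ forall n, lt m n -> x@_n = 0.

Section TranslationInvariantOrder.
Variable lt : rel (int * int).
Hypothesis lt_total : forall m n, [\/ lt m n, m = n | lt n m].
Hypothesis lt_irr : irreflexive lt.
Hypothesis lt_trans : transitive lt.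
Hypothesis lt_add : forall p m n, lt m n -> lt (p + m) (p + n).

Lemma exists_maximal (s : seq (int * int)) : s != [::] ->
  exists2 m, m \in s & forall n, n \in s -> ~~ lt m n.
Proof.
elim: s => // m [_ _|n s /(_ isT) [p ps pmax] _].
  by exists m => [|n]; rewrite inE // => /eqP ->; rewrite lt_irr.
have [mp|->|pm] := lt_total m p.
- exists p => [|k]; first by rewrite inE ps orbT.
  rewrite inE => /orP[/eqP ->|/pmax //].
  by apply/negP => /(lt_trans mp); rewrite lt_irr.
- exists p => [|k]; first by rewrite mem_head.
  by rewrite inE => /orP[/eqP ->|/pmax //]; rewrite lt_irr.
- exists m => [|k]; first by rewrite mem_head.
  rewrite inE => /orP[/eqP ->|/pmax]; first by rewrite lt_irr.
  by apply/contra/lt_trans.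
Qed.

Lemma exists_leading (x : T) : x != 0 -> exists m, leading lt x m.
Proof.
move=> x0; have : (msupp x : seq _) != [::].
  apply: contra_neq x0 => s0; rewrite (malg_basisE x) s0; exact: big_nil.
move=> /exists_maximal [m mx mmax]; exists m; split.
  by rewrite mcoeff_neq0.
move=> n mn; apply: mcoeff_outdom.
by apply/negP => /mmax; rewrite mn.
Qed.

(** In the sum for the coefficient at [m + n], an index [k] other than [m] is either above [m],
    where [x] vanishes, or has [m + n - k] above [n], where [y] vanishes. The remaining term is a
    product of nonzero scalars. *)
Lemma leadingM (x y : T) m n : leading lt x m -> leading lt y n ->
  (x * y)@_(m + n) != 0.
Proof.
move=> [xm xmax] [yn ymax]; rewrite qtorus_coefM.
have ms : m \in msupp x by rewrite -mcoeff_neq0.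
rewrite (big_fsetD1 m) //= big_seq big1 ?addr0.
  have -> : m + n - m = n by rewrite addrAC subrr add0r.
  by rewrite !mulf_neq0 ?expfz_neq0.
move=> k; rewrite !inE => /andP[km _].
have [mk|mk|km'] := lt_total m k; first by rewrite xmax // mul0r.
  by rewrite mk eqxx in km.
rewrite ymax ?mulr0 //.
by have := lt_add (n - k) km'; rewrite subrK addrAC [n + m]addrC.
Qed.

End TranslationInvariantOrder.

(** The leading exponents of [x] and [y] sum to 0, and so do the trailing ones. Since trailing never
    exceeds leading in either factor, the two agree in [x], which therefore has a single term. *)
Lemma qtorus_unit_monomial (x y : T) : x * y = 1 ->
  exists c m, c != 0 /\ x = c *: U m.
Proof.
move=> xy.
have lead0 m n : (x * y)@_(m + n) != 0 -> m + n = 0.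
  rewrite xy qtorus_1 /qtorus_U mcoeffU.
  by case: (eqVneq 0 (m + n)) => [<-|_]; rewrite ?mulr0n ?eqxx.
have x0 : x != 0 by apply: contra_eq_neq xy => ->; rewrite mul0r eq_sym oner_eq0.
have y0 : y != 0 by apply: contra_eq_neq xy => ->; rewrite mulr0 eq_sym oner_eq0.
have gt_total m n : [\/ lex_gt m n, m = n | lex_gt n m].
  by case: (lex_lt_total m n); [constructor 3|constructor 2|constructor 1].
have gt_irr : irreflexive lex_gt by exact: lex_lt_irr.
have gt_trans : transitive lex_gt.
  by move=> m n p nm mp; apply: lex_lt_trans mp nm.
have gt_add p m n : lex_gt m n -> lex_gt (p + m) (p + n) by exact: lex_ltD.
have [mx xmx] := exists_leading lex_lt_total lex_lt_irr lex_lt_trans x0.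
have [nx ynx] := exists_leading lex_lt_total lex_lt_irr lex_lt_trans y0.
have [mn xmn] := exists_leading gt_total gt_irr gt_trans x0.
have [nn ynn] := exists_leading gt_total gt_irr gt_trans y0.
have ex := lead0 _ _ (leadingM lex_lt_total lex_ltD xmx ynx).
have en := lead0 _ _ (leadingM gt_total gt_add xmn ynn).
have mE : mn = mx.
  have [lmx|//|lmx] := lex_lt_total mn mx; last first.
    by case: xmn => /negP; case; apply/eqP; apply: xmx.2.
  have [lnx|nE|lnx] := lex_lt_total nn nx; last first.
  - by case: ynn => /negP; case; apply/eqP; apply: ynx.2.
  - have := lex_ltD nn lmx.
    by rewrite addrC en nE addrC ex lex_lt_irr.
  - have := lex_lt_trans (lex_ltD nn lmx) _.
    move=> /(_ (mx + nx)); rewrite [nn + mx]addrC [nn + mn]addrC en => /(_ (lex_ltD _ lnx)).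
    by rewrite ex lex_lt_irr.
exists x@_mx, mx; split; first exact: xmx.1.
apply/malgP => k; rewrite mcoeffZ /qtorus_U mcoeffU.
case: eqP => [<-|/eqP mk]; first by rewrite mulr1.
rewrite mulr0; have [mk'|mk'|mk'] := lex_lt_total mx k.
- exact: xmx.2.
- by rewrite mk' eqxx in mk.
- by apply: xmn.2; rewrite mE.
Qed.

End LeadingTerms.

(** Supplies the [unitRingType] that [is_Ore_localization] asks for, with inverses picked by choice;
    it is applied to the torus. *)
Lemma classical_unitRing (A : nzRingType) :
  exists (B : unitRingType) (f : {rmorphism A -> B}), bijective f.
Proof.
pose is_inv (x y : A) := y * x = 1 /\ x * y = 1.
pose unit : pred A := fun x => `[< exists y, is_inv x y >].
have inv_ex x : exists y, if unit x then is_inv x y else y = x.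
  by rewrite /unit; case: asboolP => // _; exists x.
pose inv x := sval (cid (inv_ex x)).
have invP x : if unit x then is_inv x (inv x) else inv x = x.
  exact: svalP (cid (inv_ex x)).
have mulVx : {in unit, left_inverse 1 inv *%R}.
  by move=> x; rewrite -topredE /= => ux; have := invP x; rewrite ux => -[].
have mulxV : {in unit, right_inverse 1 inv *%R}.
  by move=> x; rewrite -topredE /= => ux; have := invP x; rewrite ux => -[].
have unitP x y : y * x = 1 /\ x * y = 1 -> unit x.
  by move=> ?; apply/asboolP; exists y.
have inv_out : {in [predC unit], inv =1 id}.
  move=> x; rewrite !inE -topredE /= => /negbTE ux.
  by have := invP x; rewrite ux.
pose Bmix := GRing.NzRing_hasMulInverse.Build A mulVx mulxV unitP inv_out.
pose B : unitRingType := HB.pack (GRing.NzRing.sort A) Bmix.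
exists B, (idfun : {rmorphism A -> A}).
by exists id.
Qed.

(** * The presentation of the quotient *)

Section LinearCombinations.
Variables (K : fieldType) (M : lmodType K) (u v w t : M).

(* Rewriting with these equations turns an identity between combinations of   *)
(* four vectors into identities between scalars, within reach of [field].     *)
Lemma lin_comb4 : exists L : K -> K -> K -> K -> M,
  [/\ u = L 1 0 0 0, v = L 0 1 0 0, w = L 0 0 1 0 & t = L 0 0 0 1] /\
  [/\ 0 = L 0 0 0 0,
      forall a b c d a' b' c' d',
        L a b c d + L a' b' c' d' = L (a + a') (b + b') (c + c') (d + d'),
      forall k a b c d, k *: L a b c d = L (k * a) (k * b) (k * c) (k * d) &
      forall a b c d, - L a b c d = L (- a) (- b) (- c) (- d)].
Proof.
exists (fun a b c d => a *: u + b *: v + c *: w + d *: t); split; split=> //.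
- by rewrite scale1r !scale0r !addr0.
- by rewrite scale1r !scale0r !addr0 add0r.
- by rewrite scale1r !scale0r addr0 !add0r.
- by rewrite scale1r !scale0r !add0r.
- by rewrite !scale0r !addr0.
- by move=> *; rewrite !scalerDl addrACA; congr (_ + _); rewrite addrACA;
    congr (_ + _); rewrite addrACA.
- by move=> *; rewrite !scalerDr !scalerA.
- by move=> *; rewrite !opprD !scaleNr.
Qed.

End LinearCombinations.

Section Scalars.
Variables (K : fieldType) (q : K).
Hypotheses (q_neq0 : q != 0) (q2_neq1 : q ^+ 2 - 1 != 0) (q2_neqN1 : 1 + q ^+ 2 != 0).

(** The scalars of the last of the [quotient_relations]: [kap] comes from writing the commutator of
    e2 and e3 as [kap] e3 e2 + alpha, [cc] inverts the coefficient of z e1 in z', and [bb] is beta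
    divided by the outer factor of z'. *)
Definition kap : K := q ^+ 2 - 1.
Definition cc : K := (1 + q ^- 2)^-1.
Definition bb (beta : K) : K := beta / (1 - q ^- 2).

Lemma qm2_neq0 : q ^- 2 != 0.
Proof. by rewrite invr_neq0 // expf_neq0. Qed.

Lemma add1_qm2_neq0 : 1 + q ^- 2 != 0.
Proof.
have -> : 1 + q ^- 2 = (1 + q ^+ 2) / q ^+ 2 by field.
by rewrite mulf_neq0 // qm2_neq0.
Qed.

Lemma sub1_qm2_neq0 : 1 - q ^- 2 != 0.
Proof.
have -> : 1 - q ^- 2 = (q ^+ 2 - 1) / q ^+ 2 by field.
by rewrite mulf_neq0 // qm2_neq0.
Qed.

Lemma cc_neq0 : cc != 0.
Proof. by rewrite invr_neq0 // add1_qm2_neq0. Qed.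

Lemma bb_eq0 beta : (bb beta == 0) = (beta == 0).
Proof. by rewrite /bb mulf_eq0 invr_eq0 (negPf sub1_qm2_neq0) orbF. Qed.

End Scalars.

(* The elements e1, e2, e3, z, z' of [Uplus], in an abstract algebra: their   *)
(* concrete definitions make unification intractable.                         *)
Section DerivedGenerators.
Variables (K : fieldType) (q : K) (U : algType K).

Definition derived_generators (u1 u2 u3 uz uz' : U) :=
  [/\ u3 = u1 * u2 - q ^+ 2 *: (u2 * u1),
      uz = u2 * u3 - q ^+ 2 *: (u3 * u2) &
      uz' = (1 - q ^- 2) *: (u3 * (u1 * u2 - q ^- 2 *: (u2 * u1))
                             + (1 + q ^- 2) *: (uz * u1))].

Lemma lrmorph_derived (E : algType K) (f : {lrmorphism U -> E}) u1 u2 u3 uz uz' :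
  derived_generators u1 u2 u3 uz uz' ->
  [/\ f u3 = f u1 * f u2 - q ^+ 2 *: (f u2 * f u1),
      f uz = f u2 * f u3 - q ^+ 2 *: (f u3 * f u2) &
      f uz' = (1 - q ^- 2) *: (f u3 * (f u1 * f u2 - q ^- 2 *: (f u2 * f u1))
                             + (1 + q ^- 2) *: (f uz * f u1))].
Proof.
move=> [E3 Ez Ez']; split.
- by rewrite E3 rmorphB /= linearZ !rmorphM.
- by rewrite Ez rmorphB /= linearZ !rmorphM.
rewrite Ez' [LHS]linearZ /= rmorphD rmorphM rmorphB /=.
by rewrite ![f (_ *: _)]linearZ /= !rmorphM.
Qed.

Lemma lrmorph_subC (E : algType K) (f : {lrmorphism U -> E}) u a :
  f u = a%:A -> f (u - a%:A) = 0.
Proof. by move=> fu; rewrite rmorphB /= linearZ rmorph1 /= fu subrr. Qed.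

End DerivedGenerators.

Lemma Uplus_derived (K : fieldType) (q : K) :
  derived_generators q (e1 q) (e2 q) (e3 q) (z q) (z' q).
Proof. by split. Qed.

Section Presentation.
Variables (K : fieldType) (q alpha beta : K).
Hypotheses (q_neq0 : q != 0) (q2_neq1 : q ^+ 2 - 1 != 0) (q2_neqN1 : 1 + q ^+ 2 != 0).

Local Notation kap := (kap q).
Local Notation cc := (cc q).
Local Notation bb := (bb q beta).

(* The last relation is z' = beta, rewritten with z = alpha; its left factor  *)
(* is the commutator of [x2] and [x3].                                        *)
Definition quotient_relations (E : algType K) (x1 x2 x3 : E) :=
  [/\ x1 * x2 = q ^+ 2 *: (x2 * x1) + x3,
      x3 * x1 = q ^+ 2 *: (x1 * x3),
      x2 * x3 = q ^+ 2 *: (x3 * x2) + alpha%:A &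
      (kap *: (x3 * x2) + alpha%:A) * x1 = cc *: (bb%:A - x3 ^+ 2)].

Section Lift.
Variables (E : algType K) (x1 x2 x3 : E).
Hypothesis x12 : x1 * x2 = q ^+ 2 *: (x2 * x1) + x3.
Hypothesis x31 : x3 * x1 = q ^+ 2 *: (x1 * x3).
Hypothesis x23 : x2 * x3 = q ^+ 2 *: (x3 * x2) + alpha%:A.
Hypothesis x321 : (kap *: (x3 * x2) + alpha%:A) * x1 = cc *: (bb%:A - x3 ^+ 2).

Let x13 : x1 * x3 = q ^- 2 *: (x3 * x1).
Proof. by rewrite x31 scalerA mulVf ?scale1r // expf_neq0. Qed.

Let x23B : x2 * x3 - q ^+ 2 *: (x3 * x2) = alpha%:A.
Proof. by rewrite x23 addrC addKr. Qed.

(** Substituting for [x3] in the q-commutation of [x1] and [x3] yields the first Serre relation. *)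
Fact serre1_lift : serre1 q x1 x2 = 0.
Proof.
rewrite /serre1 !expr2 -[x1 * x1 * x2]mulrA x12 mulrDr -scalerAr.
rewrite [x1 * (x2 * x1)]mulrA x12 mulrDl -scalerAl x13 mulrA.
have [L [[-> -> _ _] [-> LD LZ LN]]] := lin_comb4 (x2 * x1 * x1) (x3 * x1) 0 0.
by rewrite !(LD, LZ, LN); congr L; field; rewrite ?q_neq0.
Qed.

(** The scalar [zz] commutes with [x2]; expanded in [x1] and [x2], this is the second Serre relation
    up to the factor [- q ^+ 2]. *)
Fact serre2_lift : serre2 q x1 x2 = 0.
Proof.
pose zz := x2 * x3 - q ^+ 2 *: (x3 * x2).
have zzE : zz = alpha%:A by [].
have zzC : x2 * zz = zz * x2 by rewrite zzE -scalerAl -scalerAr mulr1 mul1r.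
have x3E : x3 = x1 * x2 - q ^+ 2 *: (x2 * x1) by rewrite x12 addrC addKr.
have : x2 * zz - zz * x2 = 0 by rewrite zzC subrr.
rewrite /zz x3E !(mulrBr, mulrBl, scalerBr, =^~ scalerAl, =^~ scalerAr, mulrA).
rewrite /serre2 !exprS !expr0 !mulr1 !mulrA.
have [L [[-> -> -> ->] [-> LD LZ LN]]] := lin_comb4 (x2 * x2 * x2 * x1)
  (x2 * x2 * x1 * x2) (x2 * x1 * x2 * x2) (x1 * x2 * x2 * x2).
rewrite !(LD, LZ, LN) => /(congr1 ( *:%R (- q ^- 2))); rewrite !LZ => L0.
by apply: etrans (etrans _ L0) _; congr L; field; rewrite ?q_neq0.
Qed.

Fact zprime_lift :
  (1 - q ^- 2) *: (x3 * (x1 * x2 - q ^- 2 *: (x2 * x1))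
    + (1 + q ^- 2) *: ((x2 * x3 - q ^+ 2 *: (x3 * x2)) * x1)) = beta%:A.
Proof.
rewrite x23B [RHS](_ : _ = (1 - q ^- 2) *: bb%:A); last first.
  by rewrite scalerA /bb mulrCA divff ?mulr1 // sub1_qm2_neq0.
congr (_ *: _); rewrite x12 -[RHS](subrK (x3 ^+ 2)).
have ccK : (1 + q ^- 2) * cc = 1 by rewrite /cc divff // add1_qm2_neq0.
have -> : bb%:A - x3 ^+ 2 =
    (1 + q ^- 2) *: ((kap *: (x3 * x2) + alpha%:A) * x1).
  by rewrite x321 scalerA ccK scale1r.
rewrite !(mulrDl, mulrDr, mulrN, scalerDr, =^~ scalerAl, =^~ scalerAr, mulrA).
rewrite -[x3 ^+ 2]/(x3 * x3) mul1r.
have [L [[-> -> -> _] [_ LD LZ LN]]] :=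
  lin_comb4 (x3 * x2 * x1) (x3 * x3) x1 0.
by rewrite !(LD, LZ, LN); congr L; rewrite /kap; field; rewrite ?q_neq0.
Qed.

Fact lift_derived (U : algType K) (phi : {lrmorphism U -> E}) u1 u2 u3 uz uz' :
  derived_generators q u1 u2 u3 uz uz' -> phi u1 = x1 -> phi u2 = x2 ->
  [/\ phi u3 = x3, phi uz = alpha%:A & phi uz' = beta%:A].
Proof.
move=> /(lrmorph_derived phi) [-> -> ->] phi1 phi2.
rewrite -zprime_lift phi1 phi2.
have x3E : x1 * x2 - q ^+ 2 *: (x2 * x1) = x3 by rewrite x12 addrC addKr.
by rewrite x3E x23B.
Qed.

Lemma Aquot_lift : exists2 psi : {rmorphism Aquot q alpha beta -> E},
  [/\ psi (te1 q alpha beta) = x1, psi (Amap q alpha beta (e2 q)) = x2 &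
      psi (te3 q alpha beta) = x3] &
  forall k u, psi (k *: u) = k *: psi u.
Proof.
have [phi0 phi0E] := free_alg_lift (fun i : 'I_2 => if i == 0 then x1 else x2).
have phi0S x : [set serre1 q (free_gen K (0 : 'I_2)) (free_gen K (1 : 'I_2));
    serre2 q (free_gen K (0 : 'I_2)) (free_gen K (1 : 'I_2))] x -> phi0 x = 0.
  move=> [->|->]; [rewrite lrmorph_serre1 !phi0E|rewrite lrmorph_serre2 !phi0E].
    exact: serre1_lift.
  exact: serre2_lift.
have [phi1 phi1E phi1Z] := alg_quot_lift phi0S.
have [phi phiE] : exists phi : {lrmorphism Uplus q -> E},
    forall x, phi (Umap q x) = phi0 x.
  (* [Uplus q] is known to be nonzero and is an algebra, so the map can be packed as an algebra
     morphism and [alg_quot_lift] applied a second time. *)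
  pose phi1B := GRing.isScalable.Build _ (Uplus q) _ _ phi1 phi1Z.
  pose phi : {lrmorphism Uplus q -> E} := HB.pack (phi1 : Uplus q -> E)
    (GRing.RMorphism.class phi1) phi1B.
  by exists phi => x; apply: phi1E.
have phi_e1 : phi (e1 q) = x1 by rewrite phiE phi0E.
have phi_e2 : phi (e2 q) = x2 by rewrite phiE phi0E.
have [phi_e3 phi_z phi_z'] := lift_derived (Uplus_derived q) phi_e1 phi_e2.
have phiS x : [set z q - alpha%:A; z' q - beta%:A] x -> phi x = 0.
  by case=> ->; [exact: (lrmorph_subC phi_z)|exact: (lrmorph_subC phi_z')].
have [psi psiE psiZ] := alg_quot_lift phiS.
by exists psi => //; split; rewrite [LHS]psiE.
Qed.

End Lift.
End Presentation.

Section QuotientAlgebra.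
Variables (K : comNzRingType) (T : algType K) (S : set T).

(** The algebra structure depends on a proof that the quotient is nonzero, so it is put on an
    isomorphic copy [A]. *)
Lemma alg_quot_algType : (1 : alg_quot S) != 0 ->
  exists (A : algType K) (i : {rmorphism alg_quot S -> A})
         (j : {rmorphism A -> alg_quot S}),
    [/\ cancel i j, cancel j i, forall k u, i (k *: u) = k *: i u &
      exists f : {lrmorphism T -> A}, forall x, f x = i (quot_map S x)].
Proof.
move=> nz.
pose nzB := GRing.PzSemiRing_isNonZero.Build (alg_quot S) nz.
pose Q1 : nzRingType := HB.pack (alg_quot S) nzB.
pose lalgB := GRing.Lmodule_isLalgebra.Build K Q1 (@quot_scalerAl _ _ S).
pose Q2 : lalgType K := HB.pack (alg_quot S) nzB lalgB.
pose algB := GRing.Lalgebra_isAlgebra.Build K Q2 (@quot_scalerAr _ _ S).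
pose A : algType K := HB.pack (alg_quot S) nzB lalgB algB.
exists A, (idfun : {rmorphism alg_quot S -> alg_quot S}),
  (idfun : {rmorphism alg_quot S -> alg_quot S}); split=> //.
pose B1 := GRing.isZmodMorphism.Build T A (quot_map S) (quot_map_is_zmod_morphism S).
pose B2 := GRing.isMonoidMorphism.Build T A (quot_map S) (quot_map_is_monoid_morphism S).
pose B3 := GRing.isScalable.Build K T A *:%R (quot_map S) (quot_map_is_scalable S).
pose f : {lrmorphism T -> A} := HB.pack (quot_map S : T -> A) B1 B2 B3.
by exists f.
Qed.

End QuotientAlgebra.

Section Presented.
Variables (K : fieldType) (q alpha beta : K).
Hypotheses (q_neq0 : q != 0) (q2_neq1 : q ^+ 2 - 1 != 0) (q2_neqN1 : 1 + q ^+ 2 != 0).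

(* The generated-by clause is stated as an induction principle.               *)
Definition presented_by (A : algType K) (y1 y2 y3 : A) :=
  [/\ quotient_relations q alpha beta y1 y2 y3,
      (forall P : A -> Prop, P 1 -> (forall u v, P u -> P v -> P (u + v)) ->
         (forall k u, P u -> P (k *: u)) -> (forall u, P u -> P (y1 * u)) ->
         (forall u, P u -> P (y2 * u)) -> forall u, P u) &
      (forall (E : algType K) (x1 x2 x3 : E),
         quotient_relations q alpha beta x1 x2 x3 ->
         exists2 psi : {rmorphism A -> E},
           [/\ psi y1 = x1, psi y2 = x2 & psi y3 = x3] &
           forall k u, psi (k *: u) = k *: psi u)].

(** The second relation is the first Serre relation rewritten with [u3], and the last one is z' =
    beta with z replaced by alpha and scalars cancelled. *)
Lemma image_relations (U A : algType K) (f : {lrmorphism U -> A})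
    (u1 u2 u3 uz uz' : U) :
  derived_generators q u1 u2 u3 uz uz' -> serre1 q u1 u2 = 0 ->
  f uz = alpha%:A -> f uz' = beta%:A ->
  quotient_relations q alpha beta (f u1) (f u2) (f u3).
Proof.
move=> /(lrmorph_derived f) [y3E fz fz'] /(congr1 f) s1 f_z f_z'.
rewrite lrmorph_serre1 rmorph0 in s1; rewrite {}f_z in fz fz'.
rewrite {}f_z' in fz'; move: y3E fz fz' s1.
move: (f u1) (f u2) (f u3) => y1 y2 y3 y3E fz fz' s1.
have r12 : y1 * y2 = q ^+ 2 *: (y2 * y1) + y3 by rewrite y3E addrC subrK.
split=> //; last first.
- move: (esym fz').
  have qB0 := sub1_qm2_neq0 q_neq0 q2_neq1.
  have qD0 := add1_qm2_neq0 q_neq0 q2_neqN1.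
  have -> : beta%:A = (1 - q ^- 2) *: (bb q beta)%:A :> A.
    by rewrite scalerA /bb mulrCA divff ?mulr1.
  move=> /(scalerI qB0) <-; rewrite r12.
  apply: (scalerI qD0); rewrite [RHS]scalerA /cc divff // scale1r.
  rewrite !(mulrDl, mulrDr, mulrN, scalerDr, =^~ scalerAl, =^~ scalerAr, mulrA).
  rewrite -[y3 ^+ 2]/(y3 * y3) mul1r.
  have [L [[-> -> -> _] [_ LD LZ LN]]] :=
    lin_comb4 (y3 * y2 * y1) (y3 * y3) y1 0.
  by rewrite !(LD, LZ, LN); congr L; rewrite /kap; field.
- by rewrite fz addrC subrK.
move: s1; rewrite /serre1 !expr2 !mulrA => s1; apply: subr0_eq; rewrite y3E.
rewrite !(mulrBl, mulrBr, scalerBr, =^~ scalerAl, =^~ scalerAr, mulrA).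
move: s1; have [L [[-> -> -> _] [-> LD LZ LN]]] :=
  lin_comb4 (y1 * y1 * y2) (y1 * y2 * y1) (y2 * y1 * y1) 0.
rewrite !(LD, LZ, LN) => /(congr1 ( *:%R (- q ^+ 2))); rewrite !LZ => L0.
by apply: etrans (etrans _ L0) _; congr L; field.
Qed.

Section Induction.
Variables (A : algType K) (m : {lrmorphism Uplus q -> A}).
Local Notation y1 := (m (e1 q)).
Local Notation y2 := (m (e2 q)).

(** Every element is a combination of images of words, and a word is handled by stripping its first
    letter. *)
Lemma image_ind (m_surj : forall u, exists x, m x = u) (P : A -> Prop) :
  P 1 -> (forall u v, P u -> P v -> P (u + v)) ->
  (forall k u, P u -> P (k *: u)) -> (forall u, P u -> P (y1 * u)) ->
  (forall u, P u -> P (y2 * u)) -> forall u, P u.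
Proof.
move=> P1 PD PZ Py1 Py2 u; have [v <-] := m_surj u.
have [x <-] := quot_map_surj v.
rewrite -[quot_map _ x]/(Umap q x) (malg_basisE x).
have P0 : P 0 by rewrite -(scale0r 1); apply: PZ.
rewrite !linear_sum /=; elim/big_ind: _ => // w _.
rewrite !linearZ /=; apply: PZ; case: w => s.
elim: s => [|i s IHs].
  have -> : << FMonom [::] >> = 1 :> free_alg K 2 by rewrite -fmE.
  by rewrite !rmorph1.
have -> : << FMonom (i :: s) >> = free_gen K i * << FMonom s >> :> free_alg K 2.
  rewrite /free_gen /GRing.mul /= fgmulUU mulr1.
  have -> // : FMonom (i :: s) = mmul (fmu i) (FMonom s).
  by apply: val_inj; rewrite /= fmM fmuE.
rewrite !rmorphM /=.
have [->|->] : i = 0 \/ i = 1 by case: i => -[|[|//]] ?; [left|right]; exact: val_inj.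
  exact: Py1.
exact: Py2.
Qed.
End Induction.

Lemma Aquot_presented : (1 : Aquot q alpha beta) != 0 ->
  exists (A : algType K) (i : {rmorphism Aquot q alpha beta -> A})
         (j : {rmorphism A -> Aquot q alpha beta}),
    [/\ cancel i j, cancel j i, forall k u, i (k *: u) = k *: i u &
      exists y2 : A, presented_by (i (te1 q alpha beta)) y2 (i (te3 q alpha beta))].
Proof.
move=> /alg_quot_algType[A [i [j [ijK jiK iZ [m mE]]]]].
exists A, i, j; split=> //; exists (i (Amap q alpha beta (e2 q))).
have {}mE : forall x, m x = i (Amap q alpha beta x) := mE.
rewrite /te1 /te3 -!mE.
have m_z : m (z q) = alpha%:A by rewrite mE Amap_z iZ rmorph1.
have m_z' : m (z' q) = beta%:A by rewrite mE Amap_z' iZ rmorph1.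
split.
- exact: (image_relations (Uplus_derived q) (Uplus_serre1 q) m_z m_z').
- apply: image_ind => u; have [x xE] := quot_map_surj (j u).
  by exists x; rewrite mE -(jiK u) -xE.
move=> E x1 x2 x3 [x12 x31 x23 x321].
have [psi [psi1 psi2 psi3] psiZ] :=
  Aquot_lift q_neq0 q2_neq1 q2_neqN1 x12 x31 x23 x321.
exists (psi \o j : {rmorphism A -> E}).
  by rewrite !mE /= !ijK.
by move=> k u; rewrite /= -[in LHS](jiK u) -iZ ijK psiZ.
Qed.

End Presented.

(** * Realisation of the relations in the quantum torus *)

Section TorusRelations.
Variables (K : fieldType) (q alpha beta : K).
Hypotheses (q_neq0 : q != 0) (q2_neq1 : q ^+ 2 - 1 != 0) (q2_neqN1 : 1 + q ^+ 2 != 0).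

(* [m_i_j] stands for Y^j X^i; the monomials are kept abstract, since the     *)
(* unifier would otherwise try to identify distinct ones by computation.      *)
Fact torus_relations_subproof (E : algType K)
    (x1 x3 m_N1_N1 m_N1_1 m_0_N1 m_1_N1 m_N1_0 m_N1_2 m_0_2 m_1_1 : E) :
  x1 * m_N1_N1 = q ^+ 2 *: m_0_N1 -> x1 * m_N1_1 = q ^- 2 *: x3 ->
  x1 * m_0_N1 = q ^+ 2 *: m_1_N1 -> m_N1_N1 * x1 = m_0_N1 ->
  m_N1_1 * x1 = x3 -> m_0_N1 * x1 = m_1_N1 ->
  x3 * m_N1_N1 = m_N1_0 -> x3 * m_N1_1 = m_N1_2 -> x3 * m_0_N1 = 1 ->
  m_N1_N1 * x3 = q ^+ 2 *: m_N1_0 -> m_N1_1 * x3 = q ^+ 2 *: m_N1_2 ->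
  m_0_N1 * x3 = 1 -> m_N1_0 * x1 = 1 -> m_N1_2 * x1 = m_0_2 ->
  x3 ^+ 2 = m_0_2 -> x3 * x1 = m_1_1 -> x1 * x3 = q ^- 2 *: m_1_1 ->
  quotient_relations q alpha beta x1
    ((cc q * bb q beta / kap q) *: m_N1_N1 + (- cc q / kap q) *: m_N1_1
     + (- alpha / kap q) *: m_0_N1) x3.
Proof.
move=> p11 p12 p13 p21 p22 p23 p31 p32 p33 p41 p42 p43 p51 p52 p6 p71 p72.
have expand := (mulrDl, mulrDr, mulrN, scalerDr, =^~ scalerAl, =^~ scalerAr, mul1r).
split.
- rewrite !expand p11 p12 p13 p21 p22 p23.
  have [L [[-> -> -> _] [_ LD LZ LN]]] := lin_comb4 m_0_N1 x3 m_1_N1 0.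
  rewrite !(LD, LZ, LN); clear -q_neq0 q2_neq1 q2_neqN1; congr L;
    by rewrite /cc /kap; field; rewrite ?q_neq0 ?q2_neq1 ?[_ + 1]addrC ?q2_neqN1.
- by rewrite p71 p72 scalerA divff ?scale1r // expf_neq0.
- rewrite !expand p31 p32 p33 p41 p42 p43.
  have [L [[-> -> -> _] [_ LD LZ LN]]] := lin_comb4 m_N1_0 m_N1_2 1 0.
  by rewrite !(LD, LZ, LN); congr L; rewrite /cc /kap; field;
    rewrite ?q_neq0 ?q2_neq1 ?[_ + 1]addrC ?q2_neqN1.
- rewrite !expand p31 p32 p33 !expand p51 p52 p6.
  have [L [[-> -> -> _] [_ LD LZ LN]]] := lin_comb4 1 m_0_2 x1 0.
  by rewrite !(LD, LZ, LN); congr L; rewrite /cc /kap; field;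
    rewrite ?q_neq0 ?q2_neq1 ?[_ + 1]addrC ?q2_neqN1.
Qed.

Local Notation T := (qtorus (qm2_neq0 q_neq0)).
Local Notation U i j := (qtorus_U (qm2_neq0 q_neq0) (i, j)).

(** With X, Y the images of e1, e3, the last relation gives the commutator as w = cc (bb - Y^2)
    X^-1, and then e2 = Y^-1 (w - alpha) / kap. *)
Definition torus_e2 : T :=
  (cc q * bb q beta / kap q) *: U (-1) (-1) + (- cc q / kap q) *: U (-1) 1
  + (- alpha / kap q) *: U 0 (-1).

Lemma torus_relations :
  quotient_relations q alpha beta (U 1 0) torus_e2 (U 0 1).
Proof.
have UU (i j k l m n : int) (c : K) :
    (q ^- 2) ^ (i * l) = c -> i + k = m -> j + l = n -> U i j * U k l = c *: U m n.
  by move=> <- <- <-; exact: qtorus_UU.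
have UU1 (i j k l m n : int) :
    (q ^- 2) ^ (i * l) = 1 -> i + k = m -> j + l = n -> U i j * U k l = U m n.
  by move=> c1 ik jl; rewrite (UU _ _ _ _ _ _ _ c1 ik jl) scale1r.
have N1 : (q ^- 2) ^ (1 * -1 : int) = q ^+ 2 by rewrite mul1r exprN1 invrK.
have N2 : (q ^- 2) ^ (-1 * 1 : int) = q ^+ 2 by rewrite mulr1 exprN1 invrK.
have P1 : (q ^- 2) ^ (1 * 1 : int) = q ^- 2 by rewrite mulr1 expr1z.
have Z1 (i : int) : (q ^- 2) ^ (0 * i) = 1 by rewrite mul0r expr0z.
have Z2 (i : int) : (q ^- 2) ^ (i * 0) = 1 by rewrite mulr0 expr0z.
exact: (torus_relations_subproof
  (UU 1 0 (-1) (-1) 0 (-1) _ N1 erefl erefl) (UU 1 0 (-1) 1 0 1 _ P1 erefl erefl)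
  (UU 1 0 0 (-1) 1 (-1) _ N1 erefl erefl) (UU1 (-1) (-1) 1 0 0 (-1) (Z2 _) erefl erefl)
  (UU1 (-1) 1 1 0 0 1 (Z2 _) erefl erefl) (UU1 0 (-1) 1 0 1 (-1) (Z2 _) erefl erefl)
  (UU1 0 1 (-1) (-1) (-1) 0 (Z1 _) erefl erefl) (UU1 0 1 (-1) 1 (-1) 2 (Z1 _) erefl erefl)
  (UU1 0 1 0 (-1) 0 0 (Z1 _) erefl erefl) (UU (-1) (-1) 0 1 (-1) 0 _ N2 erefl erefl)
  (UU (-1) 1 0 1 (-1) 2 _ N2 erefl erefl) (UU1 0 (-1) 0 1 0 0 (Z1 _) erefl erefl)
  (UU1 (-1) 0 1 0 0 0 (Z2 _) erefl erefl) (UU1 (-1) 2 1 0 0 2 (Z2 _) erefl erefl)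
  (UU1 0 1 0 1 0 2 (Z1 _) erefl erefl) (UU1 0 1 1 0 1 1 (Z1 _) erefl erefl)
  (UU 1 0 0 1 1 1 _ P1 erefl erefl)).
Qed.

End TorusRelations.

(** * Polynomials in e1 and e3 *)

Section PresentedAlgebra.
Variables (K : fieldType) (q alpha beta : K).
Hypotheses (q_neq0 : q != 0) (q2_neq1 : q ^+ 2 - 1 != 0) (q2_neqN1 : 1 + q ^+ 2 != 0).
Variables (A : algType K) (y1 y2 y3 : A).
Hypothesis y_rel : quotient_relations q alpha beta y1 y2 y3.
Implicit Types (u v : A) (a b c d n : nat).

(** The exponent of [y3] comes first, whereas the pairs indexing the torus start with the exponent
    of [y1]. *)
Definition qmon a b : A := y3 ^+ a * y1 ^+ b.
Definition comm23 : A := kap q *: (y3 * y2) + alpha%:A.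

Lemma y13 : y1 * y3 = q ^- 2 *: (y3 * y1).
Proof.
case: y_rel => _ y31 _ _.
by rewrite y31 scalerA mulVf ?scale1r // expf_neq0.
Qed.

Lemma y23 : kap q *: (y2 * y3) = q ^+ 2 *: comm23 - alpha%:A.
Proof.
case: y_rel => _ _ y23 _; rewrite y23 /comm23 !scalerDr !scalerA.
have [L [[-> -> _ _] [_ LD LZ LN]]] := lin_comb4 (y3 * y2) (1 : A) 0 0.
by rewrite !(LD, LZ, LN); congr L; rewrite /kap; ring.
Qed.

Lemma comm23_y3 : comm23 * y3 = q ^+ 2 *: (y3 * comm23).
Proof.
rewrite /comm23 mulrDl -scalerAl -mulrA scalerAr y23 mulrDr -scalerAr.
by rewrite mulrN -!scalerAl -scalerAr mul1r mulr1 subrK.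
Qed.

Lemma comm23_y1 : comm23 * y1 = cc q *: ((bb q beta)%:A - y3 ^+ 2).
Proof. by case: y_rel. Qed.

Lemma expr_qcomm (x y : A) k n : x * y = k *: (y * x) ->
  x ^+ n * y = k ^+ n *: (y * x ^+ n).
Proof.
move=> xy; elim: n => [|n IHn]; first by rewrite !expr0 mul1r mulr1 scale1r.
by rewrite [x ^+ _]exprS -mulrA IHn -scalerAr [x * (y * _)]mulrA xy -scalerAl
  scalerA -mulrA -exprSr.
Qed.

Lemma expr_qcomm_r (x y : A) k n : x * y = k *: (y * x) ->
  x * y ^+ n = k ^+ n *: (y ^+ n * x).
Proof.
move=> xy; elim: n => [|n IHn]; first by rewrite !expr0 mul1r mulr1 scale1r.
by rewrite [y ^+ _]exprS mulrA xy -scalerAl -[y * x * _]mulrA IHn -scalerAr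
  scalerA -exprS mulrA.
Qed.

Lemma monM a b c d :
  qmon a b * qmon c d = (q ^- 2) ^+ (b * c) *: qmon (a + c) (b + d).
Proof.
have y1n := expr_qcomm_r c (expr_qcomm b y13).
rewrite /qmon mulrA -[y3 ^+ a * y1 ^+ b * _]mulrA y1n -exprM.
by rewrite -scalerAr -scalerAl !exprD !mulrA.
Qed.

Lemma y1_mon a b : y1 * qmon a b = (q ^- 2) ^+ a *: qmon a b.+1.
Proof.
have -> : y1 = qmon 0 1 by rewrite /qmon expr0 mul1r expr1.
by rewrite monM mul1n.
Qed.

Lemma comm23_mon a b : comm23 * qmon a b = (q ^+ 2) ^+ a *: (y3 ^+ a * comm23 * y1 ^+ b).
Proof. by rewrite /qmon mulrA (expr_qcomm_r a comm23_y3) -scalerAl. Qed.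

(** A multiple of [y2 * y3] is a combination of [comm23] and 1, and [comm23 * y1] is a polynomial in
    [y3]; so one [y3] and one [y1] absorb a [y2]. *)
Lemma y2_mon a b : kap q *: (y2 * qmon a.+1 b.+1) =
  (q ^+ 2) ^+ a.+1 *: (cc q *: (bb q beta *: qmon a b - qmon a.+2 b))
  - alpha *: qmon a b.+1.
Proof.
have -> : qmon a.+1 b.+1 = y3 * qmon a b.+1 by rewrite /qmon exprS mulrA.
rewrite mulrA scalerAl y23 mulrBl -!scalerAl mul1r comm23_mon.
rewrite [q ^+ 2 *: (_ *: _)]scalerA -exprS.
congr (_ *: _ - _); rewrite exprS mulrA -[_ * comm23 * _]mulrA comm23_y1.
rewrite -scalerAr -scalerAl; congr (_ *: _).
by rewrite mulrBr mulrBl -scalerAr mulr1 -scalerAl -exprD addn2.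
Qed.

Local Notation T := (qtorus (qm2_neq0 q_neq0)).
Local Notation U i j := (qtorus_U (qm2_neq0 q_neq0) (i, j)).

Variable g : {rmorphism A -> T}.
Hypotheses (gZ : forall k u, g (k *: u) = k *: g u).
Hypotheses (g1 : g y1 = U 1 0) (g3 : g y3 = U 0 1).

Lemma g_mon a b : g (qmon a b) = U b%:Z a%:Z.
Proof.
have UU (i j k l m n : int) :
    (q ^- 2) ^ (i * l) = 1 -> i + k = m -> j + l = n ->
    U i j * U k l = U m n.
  by move=> c1 <- <-; rewrite [LHS]qtorus_UU /= c1 scale1r.
have Un n : (U 1 0) ^+ n = U n%:Z 0.
  elim: n => [|n IHn]; first exact: expr0.
  by rewrite [LHS]exprS IHn; apply: UU; rewrite ?mulr0 ?expr0z.
have Um n : (U 0 1) ^+ n = U 0 n%:Z.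
  elim: n => [|n IHn]; first exact: expr0.
  by rewrite [LHS]exprS IHn; apply: UU; rewrite ?mul0r ?expr0z.
rewrite /qmon rmorphM !rmorphXn /= g1 g3 Un Um.
by apply: UU; rewrite ?mul0r ?expr0z ?add0r ?addr0.
Qed.

(* Only meaningful on non-negative exponents, to which the absolute values    *)
(* are irrelevant.                                                            *)
Definition poly_part (t : T) : A := malg_ext (fun m => qmon `|m.2|%N `|m.1|%N) t.

Lemma poly_part_U i j : poly_part (U i j) = qmon `|j|%N `|i|%N.
Proof. exact: malg_extU. Qed.

Lemma poly_part_is_linear : linear poly_part.
Proof. exact: malg_ext_is_linear. Qed.

HB.instance Definition _ :=
  GRing.isLinear.Build K T A _ poly_part poly_part_is_linear.

(* Equivalently, [u] is a polynomial in [y1] and [y3]; in this form such a    *)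
(* [u] is visibly determined by its image in the torus.                       *)
Definition is_poly u := poly_part (g u) = u.

Lemma is_polyD u v : is_poly u -> is_poly v -> is_poly (u + v).
Proof. by rewrite /is_poly rmorphD linearD /= => -> ->. Qed.

Lemma is_polyZ k u : is_poly u -> is_poly (k *: u).
Proof. by rewrite /is_poly gZ linearZ /= => ->. Qed.

Lemma is_polyB u v : is_poly u -> is_poly v -> is_poly (u - v).
Proof. by rewrite /is_poly rmorphB linearB /= => -> ->. Qed.

Lemma is_poly_mon a b : is_poly (qmon a b).
Proof. by rewrite /is_poly g_mon poly_part_U. Qed.

Lemma is_poly_ind (P : A -> Prop) :
  (forall u v, P u -> P v -> P (u + v)) -> (forall k u, P u -> P (k *: u)) ->
  (forall a b, P (qmon a b)) -> forall u, is_poly u -> P u.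
Proof.
move=> PD PZ Pmon u <-; rewrite /poly_part /malg_ext.
elim/big_ind: _ => [||m _]; [|exact: PD|exact/PZ/Pmon].
by rewrite -(scale0r (qmon 0 0)); apply: PZ.
Qed.

Lemma is_poly_y1 u : is_poly u -> is_poly (y1 * u).
Proof.
move: u; apply: is_poly_ind => [u v Pu Pv|k u Pu|a b].
- by rewrite mulrDr; apply: is_polyD.
- by rewrite -scalerAr; apply: is_polyZ.
- by rewrite y1_mon; apply/is_polyZ/is_poly_mon.
Qed.

Lemma is_poly_y2 u : is_poly u -> is_poly (y2 * u * qmon 1 1).
Proof.
move: u; apply: is_poly_ind => [u v Pu Pv|k u Pu|a b].
- by rewrite mulrDr mulrDl; apply: is_polyD.
- by rewrite -scalerAr -scalerAl; apply: is_polyZ.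
rewrite -mulrA monM !addn1 -scalerAr; apply: is_polyZ.
rewrite -[_ * _]scale1r -(mulVf (q2_neq1 : kap q != 0)) -scalerA y2_mon.
apply/is_polyZ/is_polyB; last exact/is_polyZ/is_poly_mon.
apply/is_polyZ/is_polyZ/is_polyB; last exact: is_poly_mon.
exact/is_polyZ/is_poly_mon.
Qed.

Hypothesis y_ind : forall P : A -> Prop, P 1 ->
  (forall u v, P u -> P v -> P (u + v)) -> (forall k u, P u -> P (k *: u)) ->
  (forall u, P u -> P (y1 * u)) -> (forall u, P u -> P (y2 * u)) -> forall u, P u.

(** Left multiplication by [y1] preserves polynomials, and by [y2] it costs one more factor
    [y3 * y1]. The claim covers all large [n] so that sums can use a common exponent. *)
Lemma eventually_poly u :
  exists N, forall n, (N <= n)%N -> is_poly (u * qmon n n).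
Proof.
move: u; apply: y_ind => [|u v [N uN] [M vM]|k u [N uN]|u [N uN]|u [N uN]].
- by exists 0%N => n _; rewrite mul1r; apply: is_poly_mon.
- exists (maxn N M) => n; rewrite geq_max => /andP[Nn Mn].
  by rewrite mulrDl; apply: is_polyD; [exact: uN|exact: vM].
- by exists N => n Nn; rewrite -scalerAl; apply/is_polyZ/uN.
- by exists N => n Nn; rewrite -mulrA; apply/is_poly_y1/uN.
exists N.+1 => -[//|n] Nn.
have mE : qmon n.+1 n.+1 = (q ^+ 2) ^+ n *: (qmon n n * qmon 1 1).
  rewrite monM !addn1 muln1 scalerA -exprMn divff ?expr1n ?scale1r //.
  by rewrite expf_neq0.
rewrite mE -scalerAr; apply: is_polyZ; rewrite mulrA -[y2 * u * _]mulrA.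
exact/is_poly_y2/uN.
Qed.

Lemma ker_torus u : g u = 0 -> exists n, u * qmon n n = 0.
Proof.
move=> gu0; have [N /(_ N (leqnn N)) uN] := eventually_poly u.
by exists N; rewrite -uN rmorphM gu0 mul0r linear0.
Qed.

Lemma torus_fraction (t : T) : exists n u, t * g (qmon n n) = g u.
Proof.
suff [N /(_ N (leqnn N)) [u uE]] :
    exists N, forall n, (N <= n)%N -> exists u, t * g (qmon n n) = g u.
  by exists N, u.
rewrite (malg_basisE t); elim/big_ind: _ => [|s t' [N sN] [M tM]|m _].
- by exists 0%N => n _; exists 0; rewrite mul0r rmorph0.
- exists (maxn N M) => n; rewrite geq_max => /andP[Nn Mn].
  have [[u uE] [v vE]] := (sN n Nn, tM n Mn).
  by exists (u + v); rewrite mulrDl uE vE rmorphD.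
exists (`|m.1| + `|m.2|)%N => n mn.
have [a aE] : exists a : nat, m.1 + n%:Z = a%:Z.
  by exists (absz (m.1 + n%:Z)); clear -mn; lia.
have [b bE] : exists b : nat, m.2 + n%:Z = b%:Z.
  by exists (absz (m.2 + n%:Z)); clear -mn; lia.
exists (t@_m *: ((q ^- 2) ^ (m.1 * n%:Z) *: qmon b a)).
rewrite !gZ !g_mon -scalerAl; congr (_ *: _).
by case: m aE bE {mn} => i j /= aE bE; rewrite -aE -bE; exact: qtorus_UU.
Qed.

Lemma unit_monomial u v : u * v = 1 -> exists k a b c d,
  k != 0 /\ u * qmon a b = k *: qmon c d.
Proof.
move=> /(congr1 g); rewrite rmorphM rmorph1 => /qtorus_unit_monomial.
move=> [k [[i j] [k0 gu]]].
have [N /(_ N (leqnn N)) uN] := eventually_poly u.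
exists (k * (q ^- 2) ^ (i * N%:Z)); exists N; exists N.
(* These absolute values match those in [poly_part], so the signs need no discussion. *)
exists (absz (j + N%:Z)); exists (absz (i + N%:Z)); split.
  by rewrite mulf_neq0 // expfz_neq0 // qm2_neq0.
rewrite -uN rmorphM gu g_mon -scalerAl qtorus_UU scalerA linearZ /=.
by rewrite poly_part_U.
Qed.

End PresentedAlgebra.

(** * Two modules *)

Section WeightedShifts.
Variable K : fieldType.
Implicit Types (c f : nat -> K) (O P : seq_op K) (r s n : nat).

Fact seq_diag_subproof c : seq_linear (fun f k => c k * f k).
Proof. by move=> a f g k; ring. Qed.
Definition seq_diag c := SeqOp (@seq_diag_subproof c).

Fact seq_lower_subproof c : seq_linear (fun f k => c k * f k.+1).
Proof. by move=> a f g k; ring. Qed.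
Definition seq_lower c := SeqOp (@seq_lower_subproof c).

Fact seq_raise_subproof : seq_linear (fun f k => if k is j.+1 then f j else 0 : K).
Proof. by move=> a f g [|k]; rewrite ?mulr0 ?addr0. Qed.
Definition seq_raise := SeqOp seq_raise_subproof.

Definition vanishes_from n f := forall l, (n <= l)%N -> f l = 0.

(* On finitely supported sequences, [O] lowers the degree by exactly [r]      *)
(* (sequences of degree less than [r] are killed).                            *)
Definition lowers r O := forall f, (exists N, vanishes_from N f) ->
  forall n, vanishes_from n (O f) <-> vanishes_from (n + r) f.

Lemma lowers_finite r O f : lowers r O ->
  (exists N, vanishes_from N f) -> exists N, vanishes_from N (O f).
Proof.
move=> Or [N fN]; exists N; apply/(Or f); first by exists N.
by move=> l Nl; apply: fN; lia.
Qed.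

Lemma lowers1 : lowers 0 1.
Proof. by move=> f _ n; rewrite addn0. Qed.

Lemma lowersM r s O P : lowers r O -> lowers s P -> lowers (r + s) (O * P).
Proof.
move=> Or Ps f f_fin n; rewrite seq_opME addnA.
rewrite (Or _ (lowers_finite Ps f_fin)); exact: Ps.
Qed.

Lemma lowersX r O n : lowers r O -> lowers (n * r) (O ^+ n).
Proof.
move=> Or; elim: n => [|n IHn]; first exact: lowers1.
by rewrite exprS mulSn; apply: lowersM.
Qed.

Lemma lowers_diag c : (forall k, c k != 0) -> lowers 0 (seq_diag c).
Proof.
move=> c0 f _ n; rewrite addn0; split=> fn l nl; last by rewrite /= fn ?mulr0.
by have /= /eqP := fn l nl; rewrite mulf_eq0 (negPf (c0 l)) /= => /eqP.
Qed.

Lemma lowers_lower c : (forall k, c k != 0) -> lowers 1 (seq_lower c).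
Proof.
move=> c0 f _ n; rewrite addn1; split=> fn l nl; last by rewrite /= fn ?mulr0.
case: l nl => // l nl.
by have /= /eqP := fn l nl; rewrite mulf_eq0 (negPf (c0 l)) /= => /eqP.
Qed.

(** As [u] is injective and [k] nonzero, [O] and [P] kill the same sequences. If [r] and [s]
    differed, the delta sequence at the smaller of them would be killed by only one of the two
    operators. *)
Lemma lowers_unit_eq r s (u v O P : seq_op K) k : v * u = 1 -> k != 0 ->
  u * O = k *: P -> lowers r O -> lowers s P -> r = s.
Proof.
move=> vu k0 uO Or Ps.
pose delta n : nat -> K := fun l => (l == n)%:R.
have delta_fin n : vanishes_from n.+1 (delta n).
  by move=> l nl; rewrite /delta gtn_eqF.
have fin n : exists N, vanishes_from N (delta n) by exists n.+1.
have delta_n n : ~ vanishes_from n (delta n).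
  by move=> /(_ n (leqnn n)) /eqP; rewrite /delta eqxx oner_eq0.
have van0 f : vanishes_from 0 f -> f = fun=> 0.
  by move=> f0; apply/funext => l; exact: f0.
have uOP f : u (O f) = fun l => k * P f l.
  by apply/funext => l; rewrite -seq_opME uO.
have u0 f : u f = (fun=> 0) -> f = fun=> 0.
  move=> uf; rewrite -[f](seq_op1E f) -vu seq_opME uf.
  by apply/funext => l; rewrite seq_op0.
have [rs|sr|//] := ltngtP r s; exfalso.
- have Pd : P (delta r) = fun=> 0.
    apply: van0; apply: (Ps _ (fin r) 0%N).2 => l sl.
    by apply: delta_fin; lia.
  have Od : O (delta r) = fun=> 0.
    by apply: u0; rewrite uOP Pd; apply/funext => l; rewrite mulr0.
  apply: (@delta_n r); apply: (Or _ (fin r) 0%N).1.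
  by rewrite Od.
- have Od : O (delta s) = fun=> 0.
    apply: van0; apply: (Or _ (fin s) 0%N).2 => l sl.
    by apply: delta_fin; lia.
  apply: (@delta_n s); apply: (Ps _ (fin s) 0%N).1 => l _.
  have := congr1 (fun f => f l) (uOP (delta s)).
  rewrite Od seq_op0 => /esym/eqP; rewrite mulf_eq0 (negPf k0) /=.
  by move=> /eqP.
Qed.

End WeightedShifts.

Section Modules.
Variables (K : fieldType) (q alpha beta : K).
Hypotheses (q_neq0 : q != 0) (q2_neq1 : q ^+ 2 - 1 != 0) (q2_neqN1 : 1 + q ^+ 2 != 0).
Hypothesis q_not_root : forall n : nat, (0 < n)%N -> q ^+ n != 1.

Let th : K := q ^- 2.

Let th_neq0 : th != 0. Proof. exact: qm2_neq0. Qed.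

Let thX_neq1 n : (0 < n)%N -> 1 - th ^+ n != 0.
Proof.
move=> n0; rewrite subr_eq0 eq_sym /th -exprVn -exprM exprVn invr_eq1.
by apply: q_not_root; rewrite muln_gt0.
Qed.

Section LowestWeight.
Variable s : K.
Hypotheses (s_neq0 : s != 0) (s2 : s ^+ 2 = bb q beta).

(* The commutator of [lw2] and [lw3] is [seq_raise].                          *)
Definition lw1 := seq_lower (fun k => cc q * s ^+ 2 * (1 - th ^+ k.+1 ^+ 2)).
Definition lw3 := seq_diag (fun k => s * th ^+ k).
Definition lw2 := seq_diag (fun k => (kap q * s * th ^+ k)^-1)
  * (seq_raise K - alpha%:A).

(** As the commutator acts by [seq_raise], the last relation dictates the weights of [lw1]; at index
    0 it says [bb q beta = s ^+ 2], which is why [lw3] starts with a square root of [bb q beta]. *)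
Lemma lw_relations : quotient_relations q alpha beta lw1 lw2 lw3.
Proof.
split; apply: seq_opP => f [|k];
  rewrite /lw1 /lw2 /lw3 !expr2 ?seq_opE /= ?seq_opE /= ?[th ^+ _.+1]exprS ?expr0.
all: try (have t0 := expf_neq0 k th_neq0; move: (th ^+ k) t0 => t t0).
all: rewrite /th /kap /cc -?s2.
all: try by field; rewrite ?q_neq0 ?q2_neq1 ?[_ + 1]addrC ?q2_neqN1 ?s_neq0 ?t0.
Qed.

Lemma lowers_lw1 : lowers 1 lw1.
Proof.
apply: lowers_lower => k; rewrite -exprM !mulf_neq0 ?expf_neq0 ?thX_neq1 //.
exact: cc_neq0.
Qed.

Lemma lowers_lw3 : lowers 0 lw3.
Proof. by apply: lowers_diag => k; rewrite mulf_neq0 ?expf_neq0. Qed.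

End LowestWeight.

Section HighestWeight.
Hypothesis alpha_neq0 : alpha != 0.

(** The solution of [d k = q ^+ 2 * d k.+1 + alpha] with [d 0 = 0], which is the third relation for
    [hw2] and [hw3]. *)
Let d k : K := - (alpha * (1 - th ^+ k)) / kap q.

(* [hw1] is obtained by solving the last relation, in which the commutator is *)
(* diagonal with entries [alpha * th ^+ k.+1].                                *)
Definition hw2 := seq_raise K.
Definition hw3 := seq_lower (fun k => d k.+1).
Definition hw1 := seq_diag (fun k => cc q / (alpha * th ^+ k.+1))
  * ((bb q beta)%:A - hw3 ^+ 2).

Lemma hw_relations : quotient_relations q alpha beta hw1 hw2 hw3.
Proof.
split; apply: seq_opP => f [|k];
  rewrite /hw1 /hw2 /hw3 !expr2 ?seq_opE /= ?seq_opE /= /d ?[th ^+ _.+1]exprS ?expr0.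
all: try (have t0 := expf_neq0 k th_neq0; move: (th ^+ k) t0 => t t0).
all: rewrite /th /kap /cc.
all: try by field; rewrite ?q_neq0 ?q2_neq1 ?[_ + 1]addrC ?q2_neqN1 ?alpha_neq0 ?t0.
Qed.

Let d_neq0 k : d k.+1 != 0.
Proof. by rewrite /d mulf_neq0 ?invr_neq0 ?oppr_eq0 ?mulf_neq0 ?thX_neq1. Qed.

Lemma lowers_hw3 : lowers 1 hw3.
Proof. exact: lowers_lower. Qed.

Let c_neq0 k : cc q / (alpha * th ^+ k.+1) != 0.
Proof.
by rewrite mulf_neq0 ?invr_neq0 ?mulf_neq0 ?expf_neq0 // add1_qm2_neq0.
Qed.

Lemma lowers_hw1_0 : bb q beta = 0 -> lowers 2 hw1.
Proof.
move=> b0; have -> : hw1 = seq_diag (fun k => - (cc q / (alpha * th ^+ k.+1))) * hw3 ^+ 2.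
  rewrite /hw1 b0 scale0r sub0r mulrN; apply: seq_opP => f k.
  by rewrite seq_opNE !seq_opME /= mulNr.
apply: (@lowersM _ 0 2); last exact: (lowersX 2 lowers_hw3).
by apply: lowers_diag => k; rewrite oppr_eq0.
Qed.

Lemma lowers_hw1 : bb q beta != 0 -> lowers 0 hw1.
Proof.
move=> b0; apply: (@lowersM _ 0 0); first exact: lowers_diag.
move=> f [N fN] n; rewrite addn0.
have OE l : ((bb q beta)%:A - hw3 ^+ 2) f l =
    bb q beta * f l - d l.+1 * (d l.+2 * f l.+2).
  by rewrite expr2 !seq_opE.
split=> [On|fn l nl]; last by rewrite OE !fn ?mulr0 ?subrr //; lia.
(* Downward induction from the bound [N]: once [f] vanishes at [l.+2], the equation at [l] forces it
   to vanish there, since [bb q beta] is nonzero. *)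
suff fn m l : (n <= l)%N -> (N <= l + m)%N -> f l = 0.
  by move=> l nl; apply: (fn N) => //; lia.
elim: m l => [|m IHm] l nl Nl; first by apply: fN; lia.
have := On l nl; rewrite OE (IHm l.+2) ?mulr0 ?subr0; try lia.
by move/eqP; rewrite mulf_eq0 (negPf b0) /= => /eqP.
Qed.

End HighestWeight.
End Modules.

(** * Units and localisation *)

Section UnitsOfPresentedAlgebra.
Variables (K : fieldType) (q alpha beta : K).
Hypotheses (q_neq0 : q != 0) (q2_neq1 : q ^+ 2 - 1 != 0) (q2_neqN1 : 1 + q ^+ 2 != 0).
Hypothesis q_not_root : forall n : nat, (0 < n)%N -> q ^+ n != 1.
Variables (A : algType K) (y1 y2 y3 : A).
Hypothesis y_pres : presented_by q alpha beta y1 y2 y3.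
Implicit Types (u v : A) (a b c d n : nat) (k : K).

Local Notation mon := (qmon y1 y3).
Local Notation ww := (comm23 q alpha y2 y3).

Let y_rel : quotient_relations q alpha beta y1 y2 y3. Proof. by case: y_pres. Qed.

Let cc_neq0 : cc q != 0. Proof. exact: cc_neq0. Qed.

Let bb_eq0 : (bb q beta == 0) = (beta == 0). Proof. exact: bb_eq0. Qed.

Lemma exists_torus_map :
  exists g : {rmorphism A -> qtorus (qm2_neq0 q_neq0)},
    [/\ forall k u, g (k *: u) = k *: g u, g y1 = qtorus_U _ (1, 0) &
        g y3 = qtorus_U _ (0, 1)].
Proof.
case: y_pres => _ _ /(_ _ _ _ _ (torus_relations alpha beta q_neq0 q2_neq1 q2_neqN1)).
by move=> [g [g1 _ g3] gZ]; exists g.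
Qed.

Lemma unit_eq_monomial u v : u * v = 1 -> exists k a b c d,
  k != 0 /\ u * mon a b = k *: mon c d.
Proof.
move=> uv; have [g [gZ g1 g3]] := exists_torus_map.
have y_ind : forall P : A -> Prop, P 1 ->
  (forall u v, P u -> P v -> P (u + v)) -> (forall k u, P u -> P (k *: u)) ->
  (forall u, P u -> P (y1 * u)) -> (forall u, P u -> P (y2 * u)) -> forall u, P u.
  by case: y_pres.
exact: (unit_monomial q2_neq1 y_rel gZ g1 g3 y_ind uv).
Qed.

Lemma unit_exponents x1 x2 x3 r1 r3 u v k a b c d :
  quotient_relations q alpha beta x1 x2 x3 ->
  lowers r1 (x1 : seq_op K) -> lowers r3 x3 ->
  v * u = 1 -> k != 0 -> u * mon a b = k *: mon c d ->
  (a * r3 + b * r1 = c * r3 + d * r1)%N.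
Proof.
move=> x_rel x1r x3r vu k0 um.
have [_ _ /(_ _ _ _ _ x_rel) [psi [psi1 _ psi3] psiZ]] := y_pres.
have psi_mon m n : lowers (m * r3 + n * r1) (psi (mon m n)).
  rewrite /qmon rmorphM !rmorphXn /= psi1 psi3.
  by apply: lowersM; apply: lowersX.
apply: (@lowers_unit_eq _ _ _ (psi u) (psi v) (psi (mon a b)) (psi (mon c d)) k).
- by rewrite -rmorphM vu rmorph1.
- exact: k0.
- by rewrite -rmorphM um psiZ.
- exact: psi_mon.
- exact: psi_mon.
Qed.

Section UnitExponents.
Variables (u v : A) (k : K) (a b c d : nat).
Hypotheses (vu : v * u = 1) (k_neq0 : k != 0) (um : u * mon a b = k *: mon c d).

Lemma unit_exponent1 s : s ^+ 2 = bb q beta -> beta != 0 -> b = d.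
Proof.
move=> s2 b0; have s0 : s != 0 by rewrite -sqrf_eq0 s2 bb_eq0.
have := unit_exponents (lw_relations alpha q_neq0 q2_neq1 q2_neqN1 s0 s2)
  (lowers_lw1 q_neq0 q2_neqN1 q_not_root s0) (lowers_lw3 q_neq0 s0)
  vu k_neq0 um.
by rewrite !muln0 !muln1.
Qed.

Lemma unit_exponent3 : alpha != 0 -> beta != 0 -> a = c.
Proof.
move=> a0 b0; have bb0 : bb q beta != 0 by rewrite bb_eq0.
have := unit_exponents (hw_relations beta q_neq0 q2_neq1 q2_neqN1 a0)
  (lowers_hw1 q_neq0 q2_neq1 q2_neqN1 a0 bb0)
  (lowers_hw3 q2_neq1 q_not_root a0) vu k_neq0 um.
by rewrite !muln0 !muln1 !addn0.
Qed.

Lemma unit_exponent_mixed : alpha != 0 -> beta = 0 -> (a + b * 2 = c + d * 2)%N.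
Proof.
move=> a0 b0; have bb0 : bb q beta = 0 by apply/eqP; rewrite bb_eq0 b0.
have := unit_exponents (hw_relations beta q_neq0 q2_neq1 q2_neqN1 a0)
  (lowers_hw1_0 q_neq0 q2_neq1 q2_neqN1 q_not_root a0 bb0)
  (lowers_hw3 q2_neq1 q_not_root a0) vu k_neq0 um.
by rewrite !muln1.
Qed.

End UnitExponents.

(** For alpha = 0 the last relation has [y3] as a left factor: kap y3 y2 y1 + cc y3^2 is the nonzero
    scalar cc bb. *)
Lemma y3_invertible : alpha = 0 -> beta != 0 -> exists v, y3 * v = 1 /\ v * y3 = 1.
Proof.
move=> a0 b0; case: (y_rel) => y12 y31 y23 y321.
rewrite a0 !scale0r !addr0 in y23 y321.
have cb0 : cc q * bb q beta != 0 by rewrite mulf_neq0 ?cc_neq0 ?bb_eq0.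
pose v := kap q *: (y2 * y1) + cc q *: y3.
have y3v : y3 * v = (cc q * bb q beta)%:A.
  rewrite mulrDr -!scalerAr mulrA scalerAl y321 scalerBr scalerA expr2.
  by rewrite subrK.
have vy3 : v * y3 = y3 * v.
  rewrite mulrDl mulrDr -!scalerAr -!scalerAl; congr (_ *: _ + _).
  rewrite -mulrA (y13 q_neq0 y_rel) -scalerAr mulrA y23 -scalerAl scalerA.
  by rewrite mulVf ?scale1r ?mulrA // expf_neq0.
exists ((cc q * bb q beta)^-1 *: v).
by rewrite -scalerAr -scalerAl vy3 y3v scalerA mulVf // scale1r.
Qed.

Lemma ww_y2 : y2 * ww = q ^+ 2 *: (ww * y2).
Proof.
rewrite /comm23 mulrDr -scalerAr mulrA -scalerAr mulr1 scalerAl.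
rewrite (y23 y_rel) mulrBl -!scalerAl mul1r subrK.
by [].
Qed.

Lemma y1_ww : y1 * ww = ww * y1 + (kap q / q ^+ 2) *: y3 ^+ 2.
Proof.
case: (y_rel) => y12 y31 _ _.
rewrite /comm23 mulrDr mulrDl -!scalerAr -!scalerAl mulr1 mul1r mulrA.
rewrite (y13 q_neq0 y_rel) -scalerAl -mulrA y12 mulrDr -scalerAr.
rewrite -[y3 ^+ 2]/(y3 * y3) -[y3 * y2 * y1]mulrA.
have [L [[-> -> -> _] [_ LD LZ LN]]] :=
  lin_comb4 (y3 * (y2 * y1)) (y3 * y3) y1 0.
by rewrite !(LD, LZ, LN); congr L; field.
Qed.

Lemma ww_y1_0 : beta = 0 -> ww * y1 = - cc q *: y3 ^+ 2.
Proof.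
move=> b0; have bb0 : bb q beta = 0 by apply/eqP; rewrite bb_eq0 b0.
by rewrite (comm23_y1 y_rel) bb0 scale0r sub0r scalerN scaleNr.
Qed.

Lemma y1_ww_0 : beta = 0 -> y1 * ww = - (cc q / q ^+ 4) *: y3 ^+ 2.
Proof.
move=> b0; rewrite y1_ww (ww_y1_0 b0) -scalerDl; congr (_ *: _).
by rewrite /cc /kap; field; rewrite ?q_neq0 ?[_ + 1]addrC ?q2_neqN1.
Qed.

Lemma ww_invertible : alpha != 0 -> beta = 0 -> exists v, ww * v = 1 /\ v * ww = 1.
Proof.
move=> a0 b0; have wy1 := ww_y1_0 b0; have y1w := y1_ww_0 b0.
have wy2 : ww * y2 = q ^- 2 *: (y2 * ww).
  by rewrite ww_y2 scalerA mulVf ?scale1r // expf_neq0.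
have wy3 := comm23_y3 y_rel; have k23 := y23 y_rel.
move: wy1 y1w wy2 wy3 k23; move: ww => w wy1 y1w wy2 wy3 k23.
(* In the torus y2 is a combination of y3^-1 w and y3^-1, and y1 of w^-1 y3^2,  *)
(* so that Z = y2^2 y1 is a combination of w, 1 and w^-1.                      *)
pose Z := y2 * (y2 * y1); pose N := y2 * (y2 * y3 ^+ 2).
have Zw : Z * w = - (cc q / q ^+ 4) *: N.
  by rewrite /Z /N -!mulrA y1w -!scalerAr.
have wZ : w * Z = - (cc q / q ^+ 4) *: N.
  rewrite /Z mulrA wy2 -scalerAl -mulrA [w * _]mulrA wy2 -scalerAl.
  rewrite -mulrA wy1 -!scalerAr !scalerA; congr (_ *: _).
  by field.
have Nw : kap q ^+ 2 *: N = q ^+ 6 *: w ^+ 2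
    - (alpha * (q ^+ 2 + q ^+ 4)) *: w + alpha ^+ 2 *: 1.
  have -> : kap q ^+ 2 *: N = kap q *: (y2 * ((kap q *: (y2 * y3)) * y3)).
    by rewrite -scalerAl -scalerAr scalerA -expr2 /N expr2 -!mulrA.
  have wX : (q ^+ 2 *: w - alpha%:A) * y3 = y3 * (q ^+ 4 *: w - alpha%:A).
    rewrite mulrBl mulrBr -!scalerAl -!scalerAr mul1r mulr1 wy3 scalerA.
    by congr (_ *: _ - _); ring.
  rewrite k23 wX mulrA scalerAl k23 -[w ^+ 2]/(w * w).
  rewrite !(mulrDl, mulrDr, mulNr, mulrN, mulr1, mul1r, scalerDr, =^~ scalerAl, =^~ scalerAr).
  have [L [[-> -> -> _] [_ LD LZ LN]]] := lin_comb4 (w * w) w (1 : A) 0.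
  by rewrite !(LD, LZ, LN); congr L; ring.
have NE : N = kap q ^- 2 *: (q ^+ 6 *: w ^+ 2
    - (alpha * (q ^+ 2 + q ^+ 4)) *: w + alpha ^+ 2 *: 1).
  by rewrite -Nw scalerA mulVf ?scale1r // expf_neq0.
(* By [wZ] and [NE], [w * Z] is a quadratic polynomial in [w] whose constant term is a nonzero
   multiple of [alpha ^+ 2]. Solving for that term exhibits 1 as [w * V]. *)
pose x := - (kap q ^+ 2 * q ^+ 4) / (cc q * alpha ^+ 2).
pose V := x *: Z - (q ^+ 6 / alpha ^+ 2) *: w + ((q ^+ 2 + q ^+ 4) / alpha) *: 1.
have wV : w * V = 1.
  rewrite /V !(mulrDr, mulrN) -!scalerAr mulr1 wZ NE -[w ^+ 2]/(w * w).
  have [L [[-> -> -> _] [_ LD LZ LN]]] := lin_comb4 (w * w) w (1 : A) 0.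
  rewrite !(LD, LZ, LN) /x; congr L; move: cc_neq0 (q2_neq1 : kap q != 0);
    move: (cc q) (kap q) => c k c0 k0; field; rewrite ?q_neq0 ?a0 ?c0 ?k0 //.
exists V; split=> //; rewrite -wV /V !(mulrDr, mulrDl, mulrN, mulNr).
by rewrite -!scalerAr -!scalerAl mulr1 mul1r Zw wZ.
Qed.

Lemma ww_mon_succ a b : beta = 0 ->
  ww * mon a b.+1 = ((q ^+ 2) ^+ a * - cc q) *: mon a.+2 b.
Proof.
move=> b0; rewrite (comm23_mon y_rel) [y1 ^+ _]exprS mulrA -[_ * ww * y1]mulrA.
by rewrite (ww_y1_0 b0) -scalerAr -scalerAl scalerA -exprD addn2.
Qed.

(** The unit is the multiple of the commutator that becomes e1^-1 e3^2 in the localisation;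
    multiplying by it trades one [y1] for two [y3]. *)
Lemma lowering_unit : alpha != 0 -> beta = 0 -> exists y y' : A,
  [/\ y * y' = 1, y' * y = 1, y1 * y = y3 ^+ 2 &
      forall n a b, exists2 k, k != 0 &
        y ^+ n * mon a (b + n)%N = k *: mon (a + n * 2)%N b].
Proof.
move=> a0 b0; have [v [wv vw]] := ww_invertible a0 b0.
have mu0 : - (cc q / q ^+ 4) != 0.
  by rewrite oppr_eq0 mulf_neq0 ?cc_neq0 // invr_neq0 // expf_neq0.
move: (- (cc q / q ^+ 4)) mu0 (y1_ww_0 b0) => mu mu0 y1w.
exists (mu^-1 *: ww), (mu *: v); split.
- by rewrite -scalerAl -scalerAr scalerA mulVf // wv scale1r.
- by rewrite -scalerAl -scalerAr scalerA divff // vw scale1r.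
- by rewrite -scalerAr y1w scalerA mulVf // scale1r.
elim=> [|n IHn] a b.
  exists 1; first exact: oner_neq0.
  by rewrite expr0 mul1r mul0n !addn0 scale1r.
have [k k0 kE] := IHn a b.+1.
exists (k * (mu^-1 * ((q ^+ 2) ^+ (a + n * 2)%N * - cc q))).
  by rewrite !mulf_neq0 ?invr_neq0 ?oppr_eq0 ?cc_neq0 ?expf_neq0.
rewrite addnS -addSn [(_ *: ww) ^+ _]exprS -mulrA kE -scalerAr -scalerAl.
rewrite (ww_mon_succ _ _ b0) !scalerA -mulrA; congr (_ *: qmon _ _ _ _).
by clear; lia.
Qed.

Fact nat_difference m n : exists l, (m = n + l \/ n = m + l)%N.
Proof.
by have [/subnKC <-|/ltnW/subnKC <-] := leqP m n;
  [exists (n - m)%N; right|exists (m - n)%N; left]; rewrite ?addKn.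
Qed.

Section Localized.
Variables (B : unitRingType) (F : {rmorphism A -> B}).
Hypotheses (F1 : F y1 \is a GRing.unit) (F3 : F y3 \is a GRing.unit).

Lemma localized_cancel u u' a b : u * mon a b = u' * mon a b -> F u = F u'.
Proof.
have Fm : F (mon a b) \is a GRing.unit.
  by rewrite /qmon rmorphM !rmorphXn /= unitrMl ?unitrX.
move=> uu; apply: (mulIr Fm); rewrite -!rmorphM; exact: congr1 uu.
Qed.

Lemma cyclic_units y y' W :
  y * y' = 1 -> y' * y = 1 -> F y = W ->
  (forall u v, u * v = 1 -> v * u = 1 -> exists k n,
     k != 0 /\ (F u = F (k *: y ^+ n) \/ F u = F (k *: y' ^+ n))) ->
  F @` invertible A =
  [set x | exists (k : K) (i : int), k != 0 /\ x = F k%:A * W ^ i].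
Proof.
move=> yy' y'y <- Fu.
have FyV : (F y)^-1 = F y'.
  have Uy : F y \is a GRing.unit.
    by apply/unitrP; exists (F y'); rewrite -!rmorphM yy' y'y rmorph1.
  by apply: (mulrI Uy); rewrite mulrV // -rmorphM yy' rmorph1.
have FW (i : int) k : F k%:A * F y ^ i =
    F (k *: (if i is Posz n then y ^+ n else y' ^+ `|i|%N)).
  case: i => n; rewrite -[X in _ = F X]mul1r -scalerAr scalerAl [RHS]rmorphM; congr (_ * _).
    by rewrite rmorphXn.
  by rewrite [RHS]rmorphXn /= -FyV exprVn.
apply/seteqP; split=> x /=.
  move=> [u [v [uv vu]] <-]; have [k [n [k0 [FE|FE]]]] := Fu u v uv vu.
    by exists k, (Posz n); rewrite FW.
  exists k, (- n%:Z); split=> //; rewrite FE FW.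
  (* For [n = 0] the exponent is [Posz 0], so the power of [y] is selected instead of that of
     [y']. *)
  by case: n {FE} => [|n]; rewrite ?expr0 //.
move=> [k [i [k0 ->]]]; rewrite FW.
have comm_inv (s t : A) n : s * t = 1 -> t * s = 1 -> s ^+ n * t ^+ n = 1.
  by move=> st ts; rewrite -exprMn_comm ?st ?expr1n // /GRing.comm st ts.
exists (k *: (if i is Posz n then y ^+ n else y' ^+ `|i|%N)) => //.
exists (k^-1 *: (if i is Posz n then y' ^+ n else y ^+ `|i|%N)).
case: i => n; rewrite -!scalerAl -!scalerAr !scalerA divff // mulVf // !scale1r;
  by split; apply: comm_inv.
Qed.

Lemma units_alpha0 s : s ^+ 2 = bb q beta -> alpha = 0 -> beta != 0 ->
  F @` invertible A =
  [set x | exists (k : K) (i : int), k != 0 /\ x = F k%:A * F y3 ^ i].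
Proof.
move=> s2 a0 b0; have [y' [yy' y'y]] := y3_invertible a0 b0.
apply: (cyclic_units yy' y'y) => // u v uv vu.
have [k [a [b [c [d [k0 um]]]]]] := unit_eq_monomial uv.
have bd := unit_exponent1 vu k0 um s2 b0; subst d.
have y'3 n : y' ^+ n * y3 ^+ n = 1.
  by rewrite -exprMn_comm ?y'y ?expr1n // /GRing.comm yy' y'y.
have [n [cE|aE]] := nat_difference c a.
- exists k, n; split=> //; left; apply: (@localized_cancel _ _ a b).
  by rewrite um cE addnC /qmon exprD -scalerAl mulrA.
- exists k, n; split=> //; right; apply: (@localized_cancel _ _ a b).
  by rewrite um aE addnC /qmon exprD -scalerAl !mulrA y'3 mul1r.
Qed.

(** The two monomials have equal weight when [y3] counts 1 and [y1] counts 2, so they differ by a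
    power of the unit [y], up to a scalar. *)
Lemma units_beta0 : alpha != 0 -> beta = 0 ->
  F @` invertible A =
  [set x | exists (k : K) (i : int),
     k != 0 /\ x = F k%:A * ((F y1)^-1 * F y3 ^+ 2) ^ i].
Proof.
move=> a0 b0; have [y [y' [yy' y'y y1y y_mon]]] := lowering_unit a0 b0.
apply: (cyclic_units yy' y'y).
  by rewrite -rmorphXn -y1y rmorphM mulKr.
move=> u v uv vu; have [k [a [b [c [d [k0 um]]]]]] := unit_eq_monomial uv.
have abcd := unit_exponent_mixed vu k0 um a0 b0.
have y'n n : y' ^+ n * y ^+ n = 1.
  by rewrite -exprMn_comm ?y'y ?expr1n // /GRing.comm yy' y'y.
have [n [bE|dE]] := nat_difference b d.
- have [l l0 lE] := y_mon n a d.
  exists (k / l), n; split; first by rewrite mulf_neq0 ?invr_neq0.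
  left; apply: (@localized_cancel _ _ a b); rewrite um -scalerAl bE lE scalerA.
  by rewrite divfK //; congr (_ *: qmon _ _ _ _); clear -abcd bE; lia.
- have [l l0 lE] := y_mon n c b.
  exists (k * l), n; split; first by rewrite mulf_neq0.
  right; apply: (@localized_cancel _ _ a b); rewrite um.
  have -> : mon a b = l^-1 *: (y ^+ n * mon c d).
    rewrite dE lE scalerA mulVf // scale1r; congr (qmon _ _ _ _).
    by clear -abcd dE; lia.
  by rewrite -!scalerAl -scalerAr scalerA mulrA y'n mul1r mulfK.
Qed.

Lemma units_generic s : s ^+ 2 = bb q beta -> alpha != 0 -> beta != 0 ->
  F @` invertible A = [set x | exists k : K, k != 0 /\ x = F k%:A].
Proof.
move=> s2 a0 b0; apply/seteqP; split=> x /=.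
  move=> [u [v [uv vu]] <-].
  have [k [a [b [c [d [k0 um]]]]]] := unit_eq_monomial uv.
  have bd := unit_exponent1 vu k0 um s2 b0; have ac := unit_exponent3 vu k0 um a0 b0.
  exists k; split=> //; apply: (@localized_cancel _ _ a b).
  by rewrite um bd ac -scalerAl mul1r.
move=> [k [k0 ->]]; exists k%:A => //; exists k^-1%:A.
by rewrite -!scalerAl !mul1r !scalerA divff // mulVf // scale1r.
Qed.

End Localized.
End UnitsOfPresentedAlgebra.

(** * Transfer to the quotient and its Ore localisation *)

Section OreLocalization.
Variables (K : fieldType) (q alpha beta : K).
Hypotheses (q_neq0 : q != 0) (q2_neq1 : q ^+ 2 - 1 != 0) (q2_neqN1 : 1 + q ^+ 2 != 0).

Lemma Aquot_neq0 : (1 : Aquot q alpha beta) != 0.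
Proof.
have [y12 y31 y23 y321] := torus_relations alpha beta q_neq0 q2_neq1 q2_neqN1.
have [psi _ _] := Aquot_lift q_neq0 q2_neq1 q2_neqN1 y12 y31 y23 y321.
apply/eqP => /(congr1 psi); rewrite rmorph1 rmorph0 => /eqP.
by rewrite oner_eq0.
Qed.

Fact inverse_scale (E : algType K) (k : K) (x t : E) :
  k != 0 -> t * x = 1 -> x * t = 1 ->
  (k^-1 *: t) * (k *: x) = 1 /\ (k *: x) * (k^-1 *: t) = 1.
Proof.
move=> k0 tx xt; rewrite -!scalerAl -!scalerAr !scalerA tx xt.
by rewrite divff // mulVf // !scale1r.
Qed.

Fact rmorph_unit (A : pzRingType) (B : unitRingType) (f : {rmorphism A -> B}) x t :
  t * x = 1 -> x * t = 1 -> f x \is a GRing.unit.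
Proof.
by move=> tx xt; apply/unitrP; exists (f t); rewrite -!rmorphM tx xt rmorph1.
Qed.

Section Isomorphism.
Variables (Q : pzRingType) (A : algType K).
Variables (i : {rmorphism Q -> A}) (j : {rmorphism A -> Q}).
Hypotheses (ijK : cancel i j) (jiK : cancel j i).

Lemma invertible_iso (B : pzRingType) (f : {rmorphism Q -> B}) :
  f @` invertible Q = (f \o j) @` invertible A.
Proof.
apply/seteqP; split=> x [u [v [uv vu]] <-].
  exists (i u) => /=; last by rewrite ijK.
  by exists (i v); rewrite -!rmorphM uv vu rmorph1.
exists (j u) => //; exists (j v).
by rewrite -!rmorphM uv vu rmorph1.
Qed.

Variables (y1 y2 y3 : A).
Hypothesis y_pres : presented_by q alpha beta y1 y2 y3.

(** The localisation is the torus: its monomials are invertible, [torus_fraction] clears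
    denominators and [ker_torus] describes the kernel. *)
Lemma exists_Ore_localization (S : set Q) :
  (forall s, S s <-> exists (k : K) (a b : nat), k != 0 /\ s = j (k *: qmon y1 y3 a b)) ->
  exists (B : unitRingType) (f : {rmorphism Q -> B}), is_Ore_localization S f.
Proof.
move=> SE; have [y_rel y_ind _] := y_pres.
have [g [gZ g1 g3]] := exists_torus_map q_neq0 q2_neq1 q2_neqN1 y_pres.
have [B [phi [phi' phiK phi'K]]] := classical_unitRing (qtorus (qm2_neq0 q_neq0)).
have g_inv a b : exists t, t * g (qmon y1 y3 a b) = 1 /\ g (qmon y1 y3 a b) * t = 1.
  rewrite (g_mon g1 g3).
  exact: qtorus_U_inv.
have phi_inv s : S s -> phi (g (i s)) \is a GRing.unit.
  move=> /SE[k [a [b [k0 ->]]]]; rewrite jiK gZ.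
  have [t [tg gt]] := g_inv a b; have [tk kt] := inverse_scale k0 tg gt.
  exact: (rmorph_unit phi tk kt).
have S_mon n : S (j (qmon y1 y3 n n)).
  by apply/SE; exists 1, n, n; rewrite oner_neq0 scale1r.
exists B, (phi \o (g \o i)); split=> [s /phi_inv //|x|x].
- have [n [u uE]] := torus_fraction gZ g1 g3 (phi' x).
  exists (j u), (j (qmon y1 y3 n n)); split=> //=.
  have /= Us := phi_inv _ (S_mon n).
  apply: (mulIr Us); rewrite mulrVK //= !jiK -uE.
  by rewrite [RHS]rmorphM phi'K.
split=> [|[s Ss xs]] /=.
  move=> /(congr1 phi'); rewrite phiK -[X in phi' X](rmorph0 phi) phiK.
  move=> /(ker_torus q2_neq1 y_rel gZ g1 g3 y_ind) [n xn].
  exists (j (qmon y1 y3 n n)) => //.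
  by rewrite -[x]ijK -rmorphM xn rmorph0.
by apply: (mulIr (phi_inv s Ss)); rewrite -!rmorphM xs !rmorph0 mul0r.
Qed.

End Isomorphism.

Lemma Aquot_Ore_localization : exists (B : unitRingType)
  (f : {rmorphism Aquot q alpha beta -> B}),
  is_Ore_localization (Sigma q alpha beta) f.
Proof.
have [A [i [j [ijK jiK iZ [y2 y_pres]]]]] :=
  Aquot_presented q_neq0 q2_neq1 q2_neqN1 Aquot_neq0.
apply: (exists_Ore_localization ijK jiK y_pres) => s.
have sE (k : K) a b :
    j (k *: qmon (i (te1 q alpha beta)) (i (te3 q alpha beta)) a b) =
    k *: (te3 q alpha beta ^+ a * te1 q alpha beta ^+ b).
  by apply: (can_inj ijK); rewrite jiK iZ rmorphM !rmorphXn.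
by split=> -[k [a [b [k0 ->]]]]; exists k, a, b; rewrite sE.
Qed.

Hypothesis q_not_root : forall n : nat, (0 < n)%N -> q ^+ n != 1.
Variables (B : unitRingType) (f : {rmorphism Aquot q alpha beta -> B}).
Hypothesis f_loc : is_Ore_localization (Sigma q alpha beta) f.
Variable s : K.
Hypothesis s2 : s ^+ 2 = bb q beta.

Local Notation E1 := (f (te1 q alpha beta)).
Local Notation E3 := (f (te3 q alpha beta)).
Local Notation C := (fun k => f (Aconst q alpha beta k)).

Lemma Aquot_units :
  [/\ alpha = 0 -> beta != 0 -> f @` invertible (Aquot q alpha beta) =
        [set b | exists (k : K) (i : int), k != 0 /\ b = C k * E3 ^ i],
      alpha != 0 -> beta = 0 -> f @` invertible (Aquot q alpha beta) =
        [set b | exists (k : K) (i : int),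
           k != 0 /\ b = C k * (E1^-1 * E3 ^+ 2) ^ i] &
      alpha != 0 -> beta != 0 -> f @` invertible (Aquot q alpha beta) =
        [set b | exists k : K, k != 0 /\ b = C k]].
Proof.
have [A [i [j [ijK jiK iZ [y2 y_pres]]]]] :=
  Aquot_presented q_neq0 q2_neq1 q2_neqN1 Aquot_neq0.
have [f_unit _ _] := f_loc.
have F1 : (f \o j) (i (te1 q alpha beta)) \is a GRing.unit.
  rewrite /= ijK; apply: f_unit; exists 1, 0%N, 1%N.
  by rewrite oner_neq0 scale1r expr0 mul1r expr1.
have F3 : (f \o j) (i (te3 q alpha beta)) \is a GRing.unit.
  rewrite /= ijK; apply: f_unit; exists 1, 1%N, 0%N.
  by rewrite oner_neq0 scale1r expr0 mulr1 expr1.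
have jC k : j k%:A = Aconst q alpha beta k.
  by apply: (can_inj ijK); rewrite jiK iZ rmorph1.
rewrite (invertible_iso ijK f); split=> a0 b0.
- rewrite (units_alpha0 q_neq0 q2_neq1 q2_neqN1 q_not_root y_pres F1 F3 s2 a0 b0).
  by rewrite /= ijK; apply/seteqP; split=> x [k [n [k0 ->]]]; exists k, n; rewrite jC.
- rewrite (units_beta0 q_neq0 q2_neq1 q2_neqN1 q_not_root y_pres F1 F3 a0 b0).
  by rewrite /= !ijK; apply/seteqP; split=> x [k [n [k0 ->]]]; exists k, n; rewrite jC.
- rewrite (units_generic q_neq0 q2_neq1 q2_neqN1 q_not_root y_pres F1 F3 s2 a0 b0).
  by apply/seteqP; split=> x [k [k0 ->]]; exists k; rewrite /= jC.
Qed.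

End OreLocalization.

Theorem proposition3p6 (R : realType) (q alpha beta : R[i])
    (q_neq0 : q != 0) (q_not_root : forall n : nat, (0 < n)%N -> q ^+ n != 1)
    (ab_neq0 : (alpha, beta) != (0, 0)) :
  (exists (B : unitRingType) (f : {rmorphism Aquot q alpha beta -> B}),
      is_Ore_localization (Sigma q alpha beta) f) /\
  (forall (B : unitRingType) (f : {rmorphism Aquot q alpha beta -> B}),
      is_Ore_localization (Sigma q alpha beta) f ->
      let E1 := f (te1 q alpha beta) in
      let E3 := f (te3 q alpha beta) in
      [/\ alpha = 0 ->
            f @` invertible (Aquot q alpha beta) =
            [set b | exists (lambda : R[i]) (i : int),
               lambda != 0 /\ b = f (Aconst q alpha beta lambda) * E3 ^ i],
          beta = 0 ->
            f @` invertible (Aquot q alpha beta) =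
            [set b | exists (lambda : R[i]) (i : int),
               lambda != 0 /\ b = f (Aconst q alpha beta lambda) * (E1^-1 * E3 ^+ 2) ^ i] &
          alpha != 0 -> beta != 0 ->
            f @` invertible (Aquot q alpha beta) =
            [set b | exists lambda : R[i], lambda != 0 /\ b = f (Aconst q alpha beta lambda)]]).
Proof.
have q2_neq1 : q ^+ 2 - 1 != 0 by rewrite subr_eq0; apply: q_not_root.
have q2_neqN1 : 1 + q ^+ 2 != 0.
  (* If [1 + q ^+ 2 = 0] then [q ^+ 4 = 1]. *)
  apply: contraNneq (q_not_root 4%N isT) => /eqP; rewrite addrC addr_eq0 => /eqP q2.
  by rewrite (exprM q 2 2) q2 sqrrN expr1n.
split; first exact: Aquot_Ore_localization.
move=> B f f_loc E1 E3.
(* The complex square root supplies the starting eigenvalue of the lowest weight module. *)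
have [u0 u1 u2] := Aquot_units q_neq0 q2_neq1 q2_neqN1 q_not_root f_loc
  (sqrtCK (bb q beta)).
(* Since alpha and beta are not both 0, each of the first two cases makes the other parameter
   nonzero. *)
move: ab_neq0; rewrite xpair_eqE negb_and => ab.
split=> [a0|b0|a0 b0]; last exact: u2.
- by apply: u0 => //; move: ab; rewrite a0 eqxx.
- by apply: u1 => //; move: ab; rewrite b0 eqxx orbF.
Qed.
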